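(* Let $0<\alpha<1$, $\theta>0$, $c>0$, and let $\nu$ be a Thorin measure. Let $A^{(\alpha,\alpha\theta)}_{\alpha,\xi_\theta}$ correspond to a $\xi_\theta$-skewed occupation time with $\xi_\theta$ having the specific density $Q_\theta(du|\nu)/du=\kappa_\theta(1-u)^\theta\tilde Q_\theta(du|\nu)/du$, where $\kappa_\theta=1/\mathbb{E}[(1+c^\alpha M_\theta(\nu))^{-\theta}]=\exp\big(\theta\int_0^\infty\log(1+c^\alpha r)\nu(dr)\big)$ and $$\tilde Q_\theta(du|\nu)=\frac{1}{(1-u)^2}f_{c^\alpha M_\theta}\!\Big(\frac{u}{1-u}\Big|\nu\Big)du,$$ with $f_{c^\alpha M_\theta}(\cdot|\nu)$ the density of $c^\alpha M_\theta(\nu)$; that is, $\tilde Q_\theta$ is the distribution of $c^\alpha M_\theta(\nu)/(c^\alpha M_\theta(\nu)+1)$. Equivalently $\xi_\theta\overset{d}{=}M_\theta(\nu^{(c^\alpha,c^\alpha)})$. Then $A^{(\alpha,\alpha\theta)}_{\alpha,\xi_\theta}$ satisfies the following properties. (i) The Cauchy–Stieltjes transform of order $\alpha\theta$ of $A^{(\alpha,\alpha\theta)}_{\alpha,\xi_\theta}$, $\lambda\mapsto\mathbb{E}[(1+\lambda A^{(\alpha,\alpha\theta)}_{\alpha,\xi_\theta})^{-\alpha\theta}]$, is expressible as $$\int_0^1\mathbb{E}\big[(1+\lambda A^{(\alpha,\alpha\theta)}_{\alpha,p})^{-\alpha\theta}\big]Q_\theta(dp|\nu)=\int_0^1\big(q+p(1+\lambda)^\alpha\big)^{-\theta}Q_\theta(dp|\nu),\qquad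 q=1-p,$$ and equals $$\frac{\mathbb{E}[(1+(1+\lambda)^\alpha c^\alpha M_\theta(\nu))^{-\theta}]}{\mathbb{E}[(1+c^\alpha M_\theta(\nu))^{-\theta}]}.$$ (ii) Hence $A^{(\alpha,\alpha\theta)}_{\alpha,\xi_\theta}\overset{d}{=}M_{\alpha\theta}(\Lambda_{\alpha,\nu})$, and $L\overset{d}{=}G_{\alpha\theta}A^{(\alpha,\alpha\theta)}_{\alpha,\xi_\theta}$ is GGC$(\alpha\theta,\Lambda_{\alpha,\nu})$.
   Context: A Thorin measure is a sigma-finite measure $\nu$ on $(0,\infty)$ with $\int\log(1+\lambda x)\nu(dx)<\infty$ for $\lambda>0$ (finite or infinite total mass). GGC$(\theta,\nu)$ is the law with Laplace transform $\exp(-\theta\int\log(1+\lambda x)\nu(dx))$. For a Thorin measure $\nu$ and $\theta>0$, $M_\theta(\nu)$ denotes the positive random variable whose law is characterized by $\mathbb{E}[(1+\lambda M_\theta(\nu))^{-\theta}]=\exp(-\theta\int\log(1+\lambda x)\nu(dx))$, so that GGC$(\theta,\nu)$ is the law of $G_\theta M_\theta(\nu)$, with $G_\theta$ an independent Gamma variable of shape $\theta$ and scale 1; when $\nu$ is a probability measure, $M_\theta(\nu)$ is the mean of a Dirichlet process with shape $\theta\nu$. For $a>0$, $\nu^{(a,a)}$ is the image of $\nu$ under $r\mapsto ar/(ar+1)$. $X_\alpha\overset{d}{=}S_\alpha/S_\alpha'$ with $S_\alpha,S'_\alpha$ independent positive $\alpha$-stable, $\mathbb{E}[e^{-\lambda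 S_\alpha}]=e^{-\lambda^\alpha}$. For $0<p<1$, $\Lambda_{\alpha,p}$ is the law of $\frac{(p/(1-p))^{1/\alpha}X_\alpha}{1+(p/(1-p))^{1/\alpha}X_\alpha}$. $\Lambda_{\alpha,\nu}(dx)=\int_0^\infty\Lambda_{\alpha,p_\alpha(r)}(dx)\,\nu(dr)$ with $p_\alpha(r)=c^\alpha r/(1+c^\alpha r)$. $A^{(\alpha,\alpha\theta)}_{\alpha,p}$ is the time spent positive up to time 1 by a $p$-skewed generalized Bessel bridge; it has the law of $P_{\alpha,\alpha\theta}(C)$ for a two-parameter PD$(\alpha,\alpha\theta)$ random probability measure and a set $C$ with $\mathbb{E}[P_{\alpha,\alpha\theta}(C)]=p$, a law on $[0,1]$ characterized by $\mathbb{E}[(1+\lambda A^{(\alpha,\alpha\theta)}_{\alpha,p})^{-\alpha\theta}]=(1-p+p(1+\lambda)^\alpha)^{-\theta}$. For a $[0,1]$-valued $\xi$, $A^{(\alpha,\alpha\theta)}_{\alpha,\xi}$ is the variable whose conditional law given $\xi=p$ is that of $A^{(\alpha,\alpha\theta)}_{\alpha,p}$. *)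

(* Defs.v *)
From HB Require Import structures.
From mathcomp Require Import all_boot all_order all_algebra.
From mathcomp Require Import all_classical all_reals all_analysis.
From mathcomp Require Import measurable_realfun.

Set Implicit Arguments.
Unset Strict Implicit.
Unset Printing Implicit Defensive.

Import Order.TTheory GRing.Theory Num.Theory.
Import numFieldNormedType.Exports.

Local Open Scope classical_set_scope.
Local Open Scope ring_scope.

Section laws.
Context {R : realType}.

Definition thorin_integral (nu : set R -> \bar R) (l : R) : \bar R :=
  (\int[nu]_(x in `]0%R, +oo[) (ln (1 + l * x))%:E)%E.

(* Taking [fine] is harmless: the integral is finite for a Thorin measure. *)
Definition thorin_exponent (nu : set R -> \bar R) (l : R) : R :=
  fine (thorin_integral nu l).

(* A measure on [(0, oo)] is a measure on [R] that does not charge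
   [(-oo, 0]]. *)
Definition thorin (nu : {measure set R -> \bar R}) : Prop :=
  [/\ nu `]-oo, 0]%classic = 0%E,
      sigma_finite [set: R] nu &
      forall l : R, 0 < l -> (thorin_integral nu l < +oo)%E].

(* Cauchy-Stieltjes transform of order [s]: E[(1 + l X)^(- s)], X of law mu. *)
Definition cauchy_stieltjes (s : R) (mu : set R -> \bar R) (l : R) : \bar R :=
  (\int[mu]_x ((1 + l * x) `^ (- s))%:E)%E.

(* E[exp (- l X)], X of law mu. *)
Definition laplace (mu : set R -> \bar R) (l : R) : \bar R :=
  (\int[mu]_x (expR (- (l * x)))%:E)%E.

Definition is_GGC (theta : R) (nu : {measure set R -> \bar R})
    (mu : probability R R) : Prop :=
  [/\ thorin nu, mu `[0, +oo[%classic = 1%E &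
      forall l : R, 0 <= l ->
        laplace mu l = (expR (- (theta * thorin_exponent nu l)))%:E].

(* [mu] is the law of [M_theta(nu)], which is determined by its transform of
   order [theta]. It lives on [[0, oo)] rather than [(0, oo)] only in order to
   cover [nu = 0], whose [M_theta(nu)] is 0: when [nu <> 0], letting [l] tend to
   infinity in the transform shows that 0 has no mass. *)
Definition is_M_law (theta : R) (nu : {measure set R -> \bar R})
    (mu : probability R R) : Prop :=
  [/\ thorin nu, mu `[0, +oo[%classic = 1%E &
      forall l : R, 0 <= l ->
        cauchy_stieltjes theta mu l =
        (expR (- (theta * thorin_exponent nu l)))%:E].

Definition is_stable_law (alpha : R) (mu : probability R R) : Prop :=
  mu `[0, +oo[%classic = 1%E /\
  forall l : R, 0 <= l -> laplace mu l = (expR (- (l `^ alpha)))%:E.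

(* [mu] is the law of the occupation time [A^(alpha, alpha theta)_(alpha, p)],
   i.e. of [P_(alpha, alpha theta)(C)] with E[P_(alpha, alpha theta)(C)] = p;
   it is determined by its transform of order [alpha theta]. *)
Definition is_occupation_law (alpha theta p : R)
    (mu : {measure set R -> \bar R}) : Prop :=
  [/\ mu setT = 1%E, mu `[0, 1]%classic = 1%E &
      forall l : R, 0 <= l ->
        cauchy_stieltjes (alpha * theta) mu l =
        ((1 - p + p * (1 + l) `^ alpha) `^ (- theta))%:E].

Definition has_density (mu : set R -> \bar R) (f : R -> R) : Prop :=
  [/\ measurable_fun setT f, forall x : R, 0 <= f x &
      forall B, measurable B ->
        mu B = (\int[lebesgue_measure]_(x in B) (f x)%:E)%E].

Definition Gamma_fun (a : R) : R :=
  \int[lebesgue_measure]_(x in `]0, +oo[) (x `^ (a - 1) * expR (- x)).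

Definition gamma_pdf (a x : R) : R :=
  if 0 < x then x `^ (a - 1) * expR (- x) / Gamma_fun a else 0.

(* [r |-> a r / (1 + a r)]; it carries [nu] to [nu^(a,a)], and it also gives
   [p_alpha] (with [a = c^alpha]) and the map defining [Lambda_(alpha,p)]
   (with [a = (p / (1 - p))^(1/alpha)]). *)
Definition to_odds_fraction (a r : R) : R := a * r / (1 + a * r).

Lemma measurable_invr :
  measurable_fun [set: R] (@GRing.inv R).
Proof.
rewrite -(setvU [set (0 : R)]); apply/measurable_funU => [||].
- exact: measurableC.
- by [].
split; last exact: measurable_fun_set1.
apply: open_continuous_measurable_fun; last first.
  by apply/in_setP => x /= /eqP x0; exact: inv_continuous.
exact: closed_openC.
Qed.

Lemma measurable_to_odds_fraction2 :
  measurable_fun [set: R * R] (fun z : R * R => to_odds_fraction z.1 z.2).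
Proof.
have mM : measurable_fun [set: R * R] (fun z : R * R => z.1 * z.2).
  exact: measurable_funM.
apply: measurable_funM => //.
apply: (measurableT_comp measurable_invr).
exact: measurable_funD.
Qed.

Lemma measurable_to_odds_fraction a :
  measurable_fun [set: R] (to_odds_fraction a).
Proof.
exact: (measurableT_comp measurable_to_odds_fraction2 (pair1_measurable a)).
Qed.

HB.instance Definition _ a := isMeasurableFun.Build _ _ _ _
  (to_odds_fraction a) (measurable_to_odds_fraction a).

(* nu^(a,a) *)
Definition thorin_image (a : R) (nu : {measure set R -> \bar R}) :
    set R -> \bar R := pushforward nu (to_odds_fraction a).

Section thorin_image_measure.
Variables (a : R) (nu : {measure set R -> \bar R}).

Let thorin_image0 : thorin_image a nu set0 = 0%E.
Proof. exact: measure0. Qed.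

Let thorin_image_ge0 B : (0 <= thorin_image a nu B)%E.
Proof. exact: measure_ge0. Qed.

Let thorin_image_sigma_additive : semi_sigma_additive (thorin_image a nu).
Proof. exact: measure_semi_sigma_additive. Qed.

HB.instance Definition _ := isMeasure.Build _ _ _ (thorin_image a nu)
  thorin_image0 thorin_image_ge0 thorin_image_sigma_additive.

End thorin_image_measure.

(* [Lambda_(alpha,p)], with [chi] the law of [X_alpha]. *)
Definition Lambda_law (alpha : R) (chi : probability R R) (p : R) :
    probability R R :=
  distribution chi (to_odds_fraction ((p / (1 - p)) `^ alpha^-1)).

Definition p_alpha (alpha c r : R) : R := to_odds_fraction (c `^ alpha) r.

(* [Lambda_(alpha,nu)] *)
Definition Lambda_mix (alpha c : R) (chi : probability R R)
    (nu : {measure set R -> \bar R}) : set R -> \bar R :=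
  fun B => (\int[nu]_(r in `]0%R, +oo[)
              Lambda_law alpha chi (p_alpha alpha c r) B)%E.

Section Lambda_mix_measure.
Variables (alpha c : R) (chi : probability R R)
  (nu : {measure set R -> \bar R}).

Let y (r : R) : R :=
  (p_alpha alpha c r / (1 - p_alpha alpha c r)) `^ alpha^-1.

Let measurable_y : measurable_fun [set: R] y.
Proof.
apply: (measurableT_comp (measurable_powR alpha^-1)).
have mp : measurable_fun [set: R] (p_alpha alpha c).
  exact: measurable_to_odds_fraction.
apply: measurable_funM => //.
apply: (measurableT_comp measurable_invr).
exact: measurable_funB.
Qed.

Let measurable_Lambda B : measurable B ->
  measurable_fun [set: R]
    (fun r => Lambda_law alpha chi (p_alpha alpha c r) B).
Proof.
move=> mB.
pose g (z : R * R) := to_odds_fraction (y z.1) z.2.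
have mg : measurable_fun [set: R * R] g.
  have mh : measurable_fun [set: R * R] (fun z : R * R => (y z.1, z.2)).
    apply: measurable_fun_pair => //.
    exact: (measurableT_comp measurable_y measurable_fst).
  exact: (measurableT_comp measurable_to_odds_fraction2 mh).
have mA : measurable (g @^-1` B) by rewrite -[X in measurable X]setTI; exact: mg.
have -> : (fun r => Lambda_law alpha chi (p_alpha alpha c r) B) =
    (chi \o xsection (g @^-1` B)).
  apply/funext => r; rewrite /Lambda_law /distribution /pushforward /=.
  by congr (chi _); apply/seteqP; split=> x; rewrite /xsection /= inE.
exact: measurable_fun_xsection.
Qed.

Let Lambda_mix0 : Lambda_mix alpha c chi nu set0 = 0%E.
Proof.
by rewrite /Lambda_mix (eq_integral (cst 0%E)) ?integral0// => r _; rewrite measure0.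
Qed.

Let Lambda_mix_ge0 B : (0 <= Lambda_mix alpha c chi nu B)%E.
Proof. by apply: integral_ge0 => r _; exact: measure_ge0. Qed.

Let Lambda_mix_sigma_additive : semi_sigma_additive (Lambda_mix alpha c chi nu).
Proof.
move=> U mU tU mUU.
rewrite [X in _ --> X](_ : _ = (\int[nu]_(r in `]0%R, +oo[)
    (\sum_(n <oo) Lambda_law alpha chi (p_alpha alpha c r) (U n)))%E); last first.
  apply: eq_integral => r _.
  by apply/esym/cvg_lim => //; exact/measure_semi_sigma_additive.
apply/cvg_closeP; split.
  by apply: is_cvg_nneseries => n _ _; exact: integral_ge0.
rewrite closeE// integral_nneseries// => n.
apply: measurable_funTS; exact: measurable_Lambda.
Qed.

HB.instance Definition _ := isMeasure.Build _ _ _ (Lambda_mix alpha c chi nu)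
  Lambda_mix0 Lambda_mix_ge0 Lambda_mix_sigma_additive.

End Lambda_mix_measure.

(* In what follows [a = c^alpha] and [mu] is the law of [M_theta(nu)]. *)
Definition kappa (theta a : R) (mu : probability R R) : R :=
  (fine (cauchy_stieltjes theta mu a))^-1.

Definition Q_tilde (a : R) (mu : probability R R) : probability R R :=
  distribution mu (to_odds_fraction a).

(* [kappa (1 - u)^theta Q_tilde(du)] *)
Definition Q_law (theta a : R) (mu : probability R R) : set R -> \bar R :=
  fun B => (\int[Q_tilde a mu]_(u in B)
              (kappa theta a mu * (1 - u) `^ theta)%:E)%E.

(* Lebesgue densities of [Q_tilde] and [Q_law] when [f] is that of [a M]. *)
Definition Q_tilde_density (f : R -> R) (u : R) : R :=
  if 0 < u < 1 then ((1 - u) ^+ 2)^-1 * f (u / (1 - u)) else 0.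

Definition Q_density (theta a : R) (mu : probability R R) (f : R -> R)
    (u : R) : R :=
  kappa theta a mu * (1 - u) `^ theta * Q_tilde_density f u.

Definition independent_RVs d (T : measurableType d) (P : probability T R)
    (X Y : {RV P >-> R}) : Prop :=
  forall B C, measurable B -> measurable C ->
    P (X @^-1` B `&` Y @^-1` C) = (P (X @^-1` B) * P (Y @^-1` C))%E.

(* The conditional law of [Y] given [X = x] is [K x]. *)
Definition conditional_law d (T : measurableType d) (P : probability T R)
    (X Y : {RV P >-> R}) (K : R.-pker R ~> R) : Prop :=
  forall B C, measurable B -> measurable C ->
    P (X @^-1` B `&` Y @^-1` C) = (\int[distribution P X]_(x in B) K x C)%E.

End laws.

(* Main.v *)
(* Let [psi l] be the integral of [ln (1 + l x)] against [nu], and [a = c^alpha].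
   Tilting the law of [u = a M / (1 + a M)] by [(1 - u)^theta = (1 + a M)^(-theta)]
   turns [E[(1 - u + u K)^(-theta)]] into
   [E[(1 + K a M)^(-theta)] / E[(1 + a M)^(-theta)]], which is
   [exp (- theta (psi (K a) - psi a))].  Take [K = 1 + l] for the law of [xi] and
   [K = (1 + l)^alpha] for that of [A].  It remains to recognise the exponents:
   [psi ((1 + l) a) - psi a] is the Thorin integral of [nu^(a,a)] because
   [1 + l a r / (1 + a r) = (1 + (1 + l) a r) / (1 + a r)], and
   [(psi ((1 + l)^alpha a) - psi a) / alpha] is that of [Lambda_(alpha,nu)] because
   [E[ln (S' + b S) - ln (S' + y S)] =
     (ln (1 + b^alpha) - ln (1 + y^alpha)) / alpha],
   which follows from two uses of Frullani's integral.  Finally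
   [E[exp (- l G A)] = E[(1 + l A)^(- alpha theta)]]. *)
Require Import Defs.
From HB Require Import structures.
From mathcomp Require Import all_boot all_order all_algebra.
From mathcomp Require Import all_classical all_reals all_analysis.
From mathcomp Require Import measurable_realfun ring lra.

Set Implicit Arguments.
Unset Strict Implicit.
Unset Printing Implicit Defensive.

Import Order.TTheory GRing.Theory Num.Theory.
Import numFieldNormedType.Exports.
Import HBNNSimple.

Local Open Scope classical_set_scope.
Local Open Scope ring_scope.

(* The measurability proof of the map is an argument of this instance, so that it
   cannot be inferred from the set function [pushforward mu f]. *)
Local Notation pushforward_measure :=
  measure_function_pushforward__canonical__measure_function_Measure.

(** * Integration against mixtures *)

(** The obstacle is to handle expectations of logarithms whose integrability is not given. Integrals
    are only ever exchanged for nonnegative integrands. This is why [ln] enters through differences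
    [ln (S' + b S) - ln (S' + y S)] with [y < b]. Finiteness matters only where integrals are
    subtracted: for [nu] it is the Thorin condition, for the exponentials it is their known
    expectation. The root in [Lambda_(alpha,p)] is what makes the mixture over [nu] tractable. With
    [p = p_alpha(r)] the odds [p / (1 - p)] are [c^alpha r], so [y = (p / (1 - p))^(1/alpha)]
    satisfies [y^alpha = c^alpha r]. The Frullani value in [1 + y^alpha] then becomes the integrand
    of [psi], and its factor [1/alpha] is absorbed by the order [alpha theta] of the transform.
    Being Thorin includes sigma-finiteness, which for [nu^(a,a)] and [Lambda_(alpha,nu)] is
    recovered from the finiteness of their Thorin integrals. *)

Section mixtures.
Context d d' (X : measurableType d) (Y : measurableType d') {R : realType}.
Implicit Types (f : Y -> \bar R).
Local Open Scope ereal_scope.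

(** Linearity gives the case of simple functions. An increasing approximation then passes to the
    limit under [m], under each [k x] and under [nu]. Measures with a density, [Lambda_mix] and the
    law of [A] are all mixtures of this kind. *)
Lemma ge0_integral_mixture (nu : {measure set X -> \bar R}) (D : set X)
    (k : X -> {measure set Y -> \bar R}) (m : {measure set Y -> \bar R}) f :
    measurable D ->
    (forall U, measurable U -> measurable_fun [set: X] (k ^~ U)) ->
    (forall U, measurable U -> m U = \int[nu]_(x in D) k x U) ->
    (forall y, 0 <= f y) -> measurable_fun [set: Y] f ->
  \int[m]_y f y = \int[nu]_(x in D) \int[k x]_y f y.
Proof.
move=> mD mk mE f0 mf.
have sE (g : {nnsfun Y >-> R}) :
    \int[m]_y (g y)%:E = \int[nu]_(x in D) \int[k x]_y (g y)%:E.
  rewrite integralT_nnsfun sintegralE.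
  under [RHS]eq_integral do rewrite integralT_nnsfun sintegralE.
  rewrite ge0_integral_fsum//; last 2 first.
  - move=> r /=; apply: measurable_funeM.
    by apply: measurable_funTS; exact: mk.
  - by move=> r x _; exact: nnsfun_mulemu_ge0.
  apply: eq_fsbigr => r _.
  (* The scalar is pulled out of the integral for [0 <= r]; for negative [r] the level set of [g] is
     empty and both sides vanish. *)
  have [r0|r0] := leP 0%R r.
    rewrite ge0_integralZl//; first by rewrite mE.
    by apply: measurable_funTS; exact: mk.
  rewrite preimage_nnfun0// measure0 mule0 integral0_eq// => x _.
  by rewrite measure0 mule0.
pose g := nnsfun_approx measurableT mf.
have intE (p : {measure set Y -> \bar R}) :
    (\int[p]_y (g n y)%:E) @[n --> \oo] --> \int[p]_y f y.
  rewrite (eq_integral (fun y => limn (EFin \o g ^~ y))); last first.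
    move=> y _; apply/esym/cvg_lim => //; exact: cvg_nnsfun_approx.
  apply: cvg_monotone_convergence => //.
  - by move=> n; exact/measurable_EFinP.
  - by move=> n y _; rewrite lee_fin.
  - by move=> y _ a b ab; rewrite lee_fin; exact/lefP/nd_nnsfun_approx.
rewrite -(cvg_lim _ (intE m))//.
under [in LHS]eq_fun do rewrite sE.
under [RHS]eq_integral do rewrite -(cvg_lim _ (intE (k _)))//.
apply/cvg_lim => //; apply: cvg_monotone_convergence => //.
- move=> n; apply: measurable_funTS; apply: measurable_fun_integral_kernel => //.
  + by move=> y; rewrite lee_fin.
  + exact/measurable_EFinP.
- by move=> n x _; apply: integral_ge0 => y _; rewrite lee_fin.
- move=> x _ a b ab; apply: ge0_le_integral => //.
  + by move=> y _; rewrite lee_fin.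
  + exact/measurable_EFinP.
  + exact/measurable_EFinP.
  + by move=> y _; rewrite lee_fin; exact/lefP/nd_nnsfun_approx.
Qed.

End mixtures.

(* A measure with density [w] is the [mu]-mixture of the point masses
   [w x * \d_x]. *)
Lemma ge0_integral_density d (X : measurableType d) (R : realType)
    (mu m : {measure set X -> \bar R}) (w : X -> R) (f : X -> \bar R) :
    measurable_fun [set: X] w -> (forall x, 0 <= w x) ->
    (forall B, measurable B -> m B = (\int[mu]_(x in B) (w x)%:E)%E) ->
    (forall x, (0 <= f x)%E) -> measurable_fun [set: X] f ->
  (\int[m]_x f x = \int[mu]_x ((w x)%:E * f x))%E.
Proof.
move=> mw w0 mE f0 mf.
pose k x : {measure set X -> \bar R} := mscale (NngNum (w0 x)) (\d_ x).
rewrite (@ge0_integral_mixture _ _ _ _ _ mu setT k m)//.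
- apply: eq_integral => x _.
  by rewrite ge0_integral_mscale// integral_dirac// diracT mul1e.
- move=> U mU; rewrite /k /mscale/=.
  apply: emeasurable_funM; first exact/measurable_EFinP.
  exact: measurable_fun_dirac.
- move=> U mU; rewrite mE// integral_mkcond; apply: eq_integral => x _.
  have -> : k x U = ((w x)%:E * \d_x U)%E by [].
  by rewrite diracE patchE; case: ifPn => _; rewrite ?mule1// mule0.
Qed.

(** * Changes of variables for Lebesgue measure *)

Section lebesgue_substitution.
Context {R : realType}.
Local Notation mu := (@lebesgue_measure R).

Lemma integral_is_derive (f F : R -> R) (a b : R) : a < b ->
    {in `[a, b], forall x : R, is_derive x 1 F (f x)} ->
    {in `[a, b], forall x : R, {for x, continuous f}} ->
  (\int[mu]_(x in `[a, b]) (f x)%:E = (F b - F a)%:E)%E.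
Proof.
move=> ab dF cf.
have cF x : x \in `[a, b] -> {for x, continuous F}.
  by move=> /dF dFx; apply: differentiable_continuous; apply/derivable1_diffP.
rewrite (@continuous_FTC2 _ f F)//.
- by apply/continuous_in_subspaceT => x /[!inE] /cf.
- split.
  + by move=> x /subset_itv_oo_cc/dF.
  + by apply: cvg_at_right_filter; apply: cF; rewrite in_itv/= lexx ltW.
  + by apply: cvg_at_left_filter; apply: cF; rewrite in_itv/= lexx ltW.
- by move=> x /subset_itv_oo_cc/dF dFx; rewrite derive1E derive_val.
Qed.

(** Only a right limit of [F] at 0 is assumed, because the intended integrand [t^(a-1) exp(- s t^a)]
    is unbounded near 0 when [a < 1]. The half-line is therefore exhausted by the sets [[1/(n+1),
    +oo[]. *)
Lemma ge0_integral_is_derive0y (f F : R -> R) (l0 l : R) :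
    (forall x : R, 0 < x -> 0 <= f x) ->
    {in `]0, +oo[, forall x : R, is_derive x 1 F (f x)} ->
    (forall x : R, 0 < x -> {for x, continuous f}) ->
    F x @[x --> 0^'+] --> l0 -> F x @[x --> +oo] --> l ->
  (\int[mu]_(x in `]0%R, +oo[) (f x)%:E = (l - l0)%:E)%E.
Proof.
move=> f0 dFoo cf F0 Fl.
have dF (x : R) : 0 < x -> is_derive x 1 F (f x).
  by move=> x0; apply: dFoo; rewrite in_itv/= x0.
have cF (x : R) : 0 < x -> {for x, continuous F}.
  by move=> /dF dFx; apply: differentiable_continuous; apply/derivable1_diffP.
pose D n := `[n.+1%:R^-1, +oo[%classic : set R.
have n0 n : 0 < n.+1%:R^-1 :> R by rewrite invr_gt0.
have DE : \bigcup_n D n = `]0, +oo[%classic.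
  apply/seteqP; split=> [x [n _]|x]; rewrite /D/= !in_itv/= !andbT.
    exact: lt_le_trans (n0 n).
  move=> x0; have [n _ nx] := near_infty_natSinv_lt (PosNum x0).
  by exists n => //; rewrite /D/= in_itv/= andbT ltW//; apply: nx => /=.
have mf : measurable_fun (`]0%R, +oo[%classic : set R) (EFin \o f).
  apply/measurable_EFinP; apply: open_continuous_measurable_fun => // x.
  by rewrite inE/= in_itv/= andbT; exact: cf.
have intD n : (\int[mu]_(x in D n) (f x)%:E = (l - F n.+1%:R^-1)%:E)%E.
  rewrite (@ge0_continuous_FTC2y _ f F _ l)//.
  - by move=> x nx; apply: f0; exact: lt_le_trans (n0 n) nx.
  - apply/continuous_in_subspaceT => x.
    by rewrite inE/= in_itv/= andbT => nx; apply: cf; exact: lt_le_trans (n0 n) nx.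
  - by move=> x nx; have /dF[] : 0 < x := lt_trans (n0 n) nx.
  - by apply: cvg_at_right_filter; exact: cF.
  - move=> x; rewrite in_itv/= andbT => nx; rewrite derive1E.
    by have /dF ? : 0 < x := lt_trans (n0 n) nx; rewrite derive_val.
have c1 : (\int[mu]_(x in D n) (f x)%:E)%E @[n --> \oo] -->
    (\int[mu]_(x in \bigcup_n D n) (f x)%:E)%E.
  apply: ge0_nondecreasing_set_cvg_integral => //.
  - move=> m n mn; apply/subsetPset => x; rewrite /D/= !in_itv/= !andbT.
    by apply: le_trans; rewrite lef_pV2 ?posrE// ler_nat ltnS.
  - by move=> n; exact: measurable_itv.
  - move=> n; apply: measurable_funS mf => // x.
    by rewrite /D/= !in_itv/= !andbT; exact: lt_le_trans (n0 n).
  - move=> n x; rewrite /D/= !in_itv/= !andbT lee_fin => nx.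
    by apply: f0; exact: lt_le_trans (n0 n) nx.
have c2 : (\int[mu]_(x in D n) (f x)%:E)%E @[n --> \oo] --> (l - l0)%:E.
  under eq_fun do rewrite intD.
  apply: cvg_EFin; first by near=> n.
  apply: cvgB; first exact: cvg_cst.
  have /cvg_at_rightP := F0; apply; split => //.
  exact: cvg_harmonic.
by rewrite -DE -(cvg_lim _ c1)// (cvg_lim _ c2).
Unshelve. all: by end_near. Qed.

(** The image of Lebesgue measure under multiplication by [b], itself multiplied by [b], gives each
    interval its length, hence is Lebesgue measure by uniqueness. *)
Lemma ge0_integral_scale (b : R) (h : R -> \bar R) : 0 < b ->
    measurable_fun setT h -> (forall x, (0 <= h x)%E) ->
  (\int[mu]_x h x = b%:E * \int[mu]_x h (b * x)%R)%E.
Proof.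
move=> b0 mh h0.
have mb : measurable_fun [set: measurableTypeR R]
    ( *%R b : measurableTypeR R -> measurableTypeR R) by exact: measurable_funM.
pose pm : {measure set (measurableTypeR R) -> \bar R} :=
  pushforward_measure mu mb.
pose m : {measure set (measurableTypeR R) -> \bar R} :=
  mscale (NngNum (ltW b0)) pm.
rewrite (eq_measure_integral m).
  rewrite /m ge0_integral_mscale//=; congr (_ * _)%E.
  rewrite ge0_integral_pushforward//.
move=> A mA _.
apply: lebesgue_measure_unique => // X [[x y] _ <-] /=.
have -> : m `]x, y]%classic = (b%:E * mu `](x / b)%R, (y / b)%R]%classic)%E.
  congr (_ * mu _)%E; apply/seteqP; split => z /=; rewrite !in_itv/=;
    by rewrite ltr_pdivrMr// ler_pdivlMr// !(mulrC z).
rewrite !lebesgue_measure_itv/= !lte_fin ltr_pM2r ?invr_gt0//.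
case: ifPn => _; last by rewrite mule0.
by rewrite -!EFinB -EFinM -mulrBl mulrC divfK// gt_eqF.
Qed.

End lebesgue_substitution.

(** * The substitution [x = u / (1 - u)] from (0, 1) to (0, oo) *)

Section odds_substitution.
Context {R : realType}.
Local Notation mu := (@lebesgue_measure R).

(** The Jacobian of [u / (1 - u)], set to 0 outside (0, 1) so that the image measure [m1] charges
    only the positive half-line. *)
Let w (u : R) : R := if 0 < u < 1 then ((1 - u) ^+ 2)^-1 else 0.

Let w_ge0 u : 0 <= w u.
Proof. by rewrite /w; case: ifP => // _; rewrite invr_ge0 sqr_ge0. Qed.

Let measurable_w : measurable_fun [set: R] w.
Proof.
apply: measurable_fun_if => //.
- apply: measurable_and; apply: measurable_fun_ltr => //.
- apply: measurable_funTS; apply: (measurableT_comp measurable_invr).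
  by apply: measurable_funX; exact: measurable_funB.
Qed.

Let m0 (B : set (measurableTypeR R)) : \bar R := (\int[mu]_(x in B) (w x)%:E)%E.

Let m00 : m0 set0 = 0%E. Proof. exact: integral_set0. Qed.

Let m0_ge0 B : (0 <= m0 B)%E.
Proof. by apply: integral_ge0 => x _; rewrite lee_fin. Qed.

Let m0_sigma_additive : semi_sigma_additive m0.
Proof.
apply: semi_sigma_additive_nng_induced; first exact/measurable_EFinP.
by move=> x; rewrite lee_fin.
Qed.

HB.instance Definition _ := isMeasure.Build _ _ _ m0 m00 m0_ge0 m0_sigma_additive.

Let odds (u : measurableTypeR R) : measurableTypeR R := u / (1 - u).

Let measurable_odds : measurable_fun setT odds.
Proof.
apply: measurable_funM => //; apply: (measurableT_comp measurable_invr).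
exact: measurable_funB.
Qed.

Let m1 : {measure set (measurableTypeR R) -> \bar R} :=
  pushforward_measure m0
    measurable_odds.

Let odds_itv (a b u : R) : 0 <= a < b -> 0 < u < 1 ->
  (a < u / (1 - u) <= b) = (a / (1 + a) < u <= b / (1 + b)).
Proof.
move=> /andP[a0 ab] /andP[u0 u1].
rewrite ltr_pdivlMr ?ler_pdivrMr ?ltr_pdivrMr ?ler_pdivlMr ?subr_gt0//; lra.
Qed.

Let m1_itv (a b : R) : 0 <= a < b -> m1 `]a, b]%classic = (b - a)%:E.
Proof.
move=> /andP[a0 ab]; have b0 := le_lt_trans a0 ab.
have ltab : a / (1 + a) < b / (1 + b).
  rewrite ltr_pdivrMr; last lra.
  by rewrite mulrAC ltr_pdivlMr; lra.
have b1 : b / (1 + b) < 1 by rewrite ltr_pdivrMr; lra.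
have a1 : 0 <= a / (1 + a) by rewrite divr_ge0//; lra.
transitivity (\int[mu]_(u in `](a / (1 + a))%R, (b / (1 + b))%R]) (w u)%:E)%E.
  rewrite /m1/= /pushforward /m0 integral_mkcond [RHS]integral_mkcond.
  apply: eq_integral => u _; rewrite !patchE.
  have [u01|/negP u01] := boolP (0 < u < 1); last first.
    by rewrite /w (negbTE (introN idP u01)); case: ifP; case: ifP.
  have /andP[u0 u1] := u01.
  by congr (if _ then _ else _); apply/idP/idP;
    rewrite !inE/= !in_itv/= /odds odds_itv// a0.
rewrite integral_itv_obnd_cbnd; last by apply/measurable_EFinP; exact: measurable_funTS.
rewrite (@eq_integral_itv_bounded _ _ _ (fun u => ((1 - u) ^+ 2)^-1))//.
(* The primitive [(1 - u)^-1] takes the value [1 + x] at [u = x / (1 + x)], so the increment is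
   [b - a]. *)
- rewrite (@integral_is_derive _ _ (fun u => (1 - u)^-1))//.
  + have onemE (x : R) : 0 <= x -> (1 - x / (1 + x))^-1 = 1 + x.
      move=> x0; rewrite -[RHS]invrK; congr (_^-1); field.
      by rewrite gt_eqF//; lra.
    by congr EFin; rewrite !onemE; lra.
  + move=> u; rewrite in_itv/= => /andP[_ ub].
    have u1 : 0 < 1 - u by lra.
    have dB : is_derive u 1 (fun u : R => 1 - u) (0 - 1) by exact: is_deriveB.
    apply: (is_derive_eq (@is_deriveV _ (fun u => 1 - u) _ _ _ _ dB)).
      by rewrite gt_eqF.
    by rewrite sub0r scalerN scaleNr opprK /GRing.scale/= mulr1.
  + move=> u; rewrite in_itv/= => /andP[_ ub].
    have u1 : 1 - u != 0 by rewrite gt_eqF//; lra.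
    apply: (continuous_comp (f := fun u : R => (1 - u) ^+ 2) (g := @GRing.inv R)).
      apply: (continuous_comp (f := fun u : R => 1 - u) (g := fun u : R => u ^+ 2)).
        by apply: cvgB; [exact: cvg_cst|exact: cvg_id].
      exact: exprn_continuous.
    by apply: inv_continuous; rewrite expf_neq0.
- exact: measurable_funTS.
- apply: measurable_funTS; apply: (measurableT_comp measurable_invr).
  by apply: measurable_funX; exact: measurable_funB.
- move=> u; rewrite in_itv/= /w => /andP[au ub].
  by rewrite (le_lt_trans a1 au) (lt_trans ub b1).
Qed.

(** Uniqueness of Lebesgue measure concerns the whole line, whereas [m1] sees only its positive
    half. Adding [m2], Lebesgue measure on the other half, gives a measure to which uniqueness
    applies; the cases below are the positions of 0 relative to an interval []x, y]]. *)
Let lebesgue_odds (A : set (measurableTypeR R)) :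
  measurable A -> A `<=` `]0, +oo[%classic -> mu A = m1 A.
Proof.
move=> mA A0; pose N : set (measurableTypeR R) := `]-oo, 0]%classic.
have mN : measurable N by exact: measurable_itv.
pose m2 : {measure set (measurableTypeR R) -> \bar R} := mrestr mu mN.
have m2E B : m2 B = mu (B `&` N) by [].
have m1N B : B `<=` N -> m1 B = 0%E.
  move=> BN; rewrite /m1/= /pushforward /m0 integral0_eq// => u /= /BN.
  rewrite /N/= in_itv/= /odds => u0; rewrite /w; case: ifPn => // /andP[u0' u1].
  by move: u0; rewrite leNgt divr_gt0// subr_gt0.
rewrite (@lebesgue_measure_unique _ (measure_add m1 m2)) => [|X [[x y] _ <-]|//]; last first.
  rewrite [RHS](measure_addE m1 m2) m2E /=.
  have [yx|xy] := leP y x; first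
    by rewrite set_itv_ge ?bnd_simp -?leNgt// set0I m1N// !measure0 add0e.
  have [y0|y0] := leP y 0.
    have xyN : `]x, y]%classic `<=` N.
      by move=> z; rewrite /N/= !in_itv/= => /andP[_ /le_trans]; exact.
    by rewrite m1N// add0e setIidl.
  have [x0|x0] := leP 0 x.
    rewrite m1_itv ?x0// (_ : _ `&` _ = set0) ?measure0 ?adde0.
      by rewrite lebesgue_measure_itv/= lte_fin xy.
    rewrite -subset0 => z []; rewrite /N/= !in_itv/= => /andP[xz _].
    by rewrite leNgt (le_lt_trans x0 xz).
  have -> : `]x, y]%classic `&` N = `]x, 0]%classic.
    apply/seteqP; split => z; rewrite /N/= !in_itv/=.
      by move=> [/andP[-> _] ->].
    by move=> /andP[-> z0]; split => //; exact: le_trans z0 (ltW y0).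
  have -> : m1 `]x, y]%classic = y%:E.
    rewrite (@itv_bndbnd_setU _ _ _ (BRight 0)) ?bnd_simp ?ltW//.
    rewrite measureU//; last first.
      rewrite -subset0 => z []/=; rewrite !in_itv/= => /andP[_ z0] /andP[].
      by rewrite ltNge z0.
    transitivity (m1 `]x, 0%R]%classic + m1 `]0%R, y]%classic)%E => //.
    rewrite m1N ?m1_itv ?lexx ?add0e ?subr0//.
    by move=> z; rewrite /N/= !in_itv/= => /andP[].
  by rewrite !lebesgue_measure_itv/= !lte_fin xy x0 add0e.
rewrite [LHS](measure_addE m1 m2) m2E (_ : A `&` N = set0) ?measure0 ?adde0//.
rewrite -subset0 => x [/A0]; rewrite /N/= !in_itv/= andbT => x0.
by rewrite leNgt x0.
Qed.

Lemma ge0_integral_odds (h : R -> \bar R) :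
    measurable_fun setT h -> (forall x, (0 <= h x)%E) ->
  (\int[mu]_(x in `]0%R, +oo[) h x =
   \int[mu]_(u in `]0%R, 1%R[) ((((1 - u) ^+ 2)^-1)%:E * h (u / (1 - u))%R))%E.
Proof.
move=> mh h0; rewrite (eq_measure_integral m1); last exact: lebesgue_odds.
pose h' := h \_ (`]0%R, +oo[%classic : set R).
have h'0 x : (0 <= h' x)%E by exact: erestrict_ge0.
have mh' : measurable_fun setT h'.
  by apply/(measurable_restrictT h) => //; exact: measurable_funTS.
rewrite integral_mkcond -/h' /m1/= ge0_integral_pushforward// preimage_setT.
rewrite (@ge0_integral_density _ _ _ mu m0 w)//; last 2 first.
- by move=> x; exact: h'0.
- exact: measurableT_comp.
rewrite [RHS]integral_mkcond; apply: eq_integral => u _.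
rewrite /h' /= !patchE !mem_setE/= !in_itv/= andbT /w /odds.
case: ifPn => u01; last by rewrite mul0e.
by have /andP[u0 u1] := u01; rewrite divr_gt0// subr_gt0.
Qed.

End odds_substitution.

(** * Frullani's integral *)

Section frullani.
Context {R : realType}.
Local Notation mu := (@lebesgue_measure R).

Lemma cvgy_powR (a : R) : 0 < a -> x `^ a @[x --> +oo] --> +oo.
Proof.
move=> a0; apply/cvgryPge => A; near=> x.
rewrite (le_trans (ler_norm A))// -[leLHS]powRr1// -(mulVf (lt0r_neq0 a0)) powRrM.
by apply: ge0_ler_powR; rewrite ?nnegrE ?powR_ge0 ?(ltW a0)//; near: x;
  apply: nbhs_pinfty_ge; rewrite num_real.
Unshelve. all: by end_near. Qed.

Let is_derive_expRN_powR (a s t : R) : 0 < t ->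
  is_derive t 1 (fun t => expR (- (s * t `^ a)))
    (- (a * s * t `^ (a - 1) * expR (- (s * t `^ a)))).
Proof.
move=> t0.
have dp := is_derive1_powR a t0.
have dl : is_derive t 1 (fun t => - (s * t `^ a)) (- (s * (a * t `^ (a - 1)))).
  by apply: is_deriveN; exact: is_deriveZ.
apply: (is_derive_eq (is_derive1_comp (is_derive_expR _) dl)); ring.
Qed.

Let continuous_expRN_powR (a s t : R) : 0 < t ->
  {for t, continuous (fun t => t `^ (a - 1) * expR (- (s * t `^ a)))}.
Proof.
move=> t0.
have cp b : {for t, continuous (fun x => x `^ b)}.
  apply: differentiable_continuous; apply/derivable1_diffP.
  by have [] := is_derive1_powR b t0.
apply: continuousM; first exact: cp.
apply: differentiable_continuous; apply/derivable1_diffP.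
by have [] := is_derive_expRN_powR a s t0.
Qed.

Let integral_powR_expRN (a s : R) : 0 < a -> 0 < s ->
  (\int[mu]_(t in `]0%R, +oo[) (t `^ (a - 1) * expR (- (s * t `^ a)))%:E =
   ((a * s)^-1)%:E)%E.
Proof.
move=> a0 s0; have as0 : a * s != 0 by rewrite mulf_neq0 ?gt_eqF.
rewrite (@ge0_integral_is_derive0y _ _
    (fun t => - (a * s)^-1 * expR (- (s * t `^ a))) (- (a * s)^-1) 0).
- by rewrite sub0r opprK.
- by move=> t t0; rewrite mulr_ge0// ?powR_ge0 ?expR_ge0.
- move=> t; rewrite in_itv/= andbT => t0.
  apply: (is_derive_eq (is_deriveZ _ (is_derive_expRN_powR a s t0))).
  by rewrite /GRing.scale/= mulrNN -(mulrA (a * s)) mulKf.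
- by move=> t; exact: continuous_expRN_powR.
- rewrite -[X in _ --> X]mulr1; apply: cvgM; first exact: cvg_cst.
  have h : - (s * t `^ a) @[t --> 0^'+] --> - (s * 0).
    by apply: cvgN; apply: cvgM; [exact: cvg_cst|exact: powR_cvg0].
  have := cvg_comp _ _ h (@continuous_expR R (- (s * 0))).
  by rewrite mulr0 oppr0 expR0.
- rewrite -[X in _ --> X](mulr0 (- (a * s)^-1)); apply: cvgM; first exact: cvg_cst.
  apply: (cvg_comp _ _ _ (@cvgr_expR R)).
  apply: gt0_cvgMry => //; exact: cvgy_powR.
Qed.

(** For [t > 0] the integrand is the integral of [t^(a-1) exp(- s t^a)] over [s] in [[C, D]]. By
    Tonelli [t] may be integrated first, which leaves [1 / (a s)], whose integral over [[C, D]] is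
    the right-hand side. *)
Lemma frullani_powR (a C D : R) : 0 < a -> 0 < C -> C < D ->
  (\int[mu]_(t in `]0%R, +oo[)
     ((expR (- (C * t `^ a)) - expR (- (D * t `^ a))) / t)%:E =
   (a^-1 * (ln D - ln C))%:E)%E.
Proof.
move=> a0 C0 CD.
pose g (z : R * R) : \bar R :=
  (\1_(`[C, D] `*` `]0%R, +oo[) z *
   (z.2 `^ (a - 1) * expR (- (z.1 * z.2 `^ a))))%:E.
have g0 z : (0 <= g z)%E.
  by rewrite lee_fin mulr_ge0// mulr_ge0 ?powR_ge0 ?expR_ge0.
have mp b : measurable_fun setT (fun z : R * R => z.2 `^ b).
  exact: (measurableT_comp (measurable_powR b)).
have mg : measurable_fun setT g.
  apply/measurable_EFinP; apply: measurable_funM.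
    by apply: measurable_indic; exact: measurableX.
  apply: measurable_funM => //.
  apply: measurableT_comp => //; apply: measurable_funN.
  apply: measurable_funM => //.
transitivity (\int[mu]_t \int[mu]_s g (s, t))%E.
  rewrite integral_mkcond; apply: eq_integral => t _; rewrite patchE.
  case: ifPn => [|/negP t0]; last first.
    rewrite integral0_eq// => s _; rewrite /g indicE memNset ?mul0r// => -[_]/=.
    by move=> /mem_set.
  rewrite inE/= in_itv/= andbT => t0.
  transitivity (\int[mu]_(s in `[C, D]) (t `^ (a - 1) * expR (- (s * t `^ a)))%:E)%E; last first.
    rewrite integral_mkcond; apply: eq_integral => s _; rewrite patchE /g indicE.
    by rewrite in_setX/= [X in _ && X]mem_set/= ?in_itv/= ?t0// andbT; case: (s \in _);
      rewrite ?mul1r ?mul0r.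
  have dE (s : R) : is_derive s 1 (fun s => expR (- (s * t `^ a)))
      (expR (- (s * t `^ a)) * - t `^ a).
    have dl : is_derive s 1 (fun s => - (s * t `^ a)) (- t `^ a).
      apply: is_deriveN; under eq_fun do rewrite mulrC.
      by apply: (is_derive_eq (is_deriveZ _ (is_derive_id _ _))); rewrite scaler1.
    exact: is_derive1_comp (is_derive_expR _) dl.
  rewrite (@integral_is_derive _ _ (fun s => - t^-1 * expR (- (s * t `^ a))))//.
  + by congr EFin; ring.
  + move=> s _; apply: (is_derive_eq (is_deriveZ _ (dE s))).
    rewrite /GRing.scale/= -(mulr_powRB1 (ltW t0) a0); field.
    by rewrite gt_eqF.
  + move=> s _; apply: cvgM; first exact: cvg_cst.
    by have [/derivable1_diffP/differentiable_continuous] := dE s.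
rewrite -(@fubini_tonelli _ _ _ _ _ mu mu g)//.
transitivity (\int[mu]_(s in `[C, D]) ((a * s)^-1)%:E)%E.
  rewrite [RHS]integral_mkcond; apply: eq_integral => s _; rewrite patchE.
  case: ifPn => [|/negP sCD]; last first.
    rewrite integral0_eq// => t _; rewrite /g indicE memNset ?mul0r// => -[]/=.
    by move=> /mem_set.
  rewrite inE/= in_itv/= => /andP[Cs sD].
  rewrite -integral_powR_expRN//; last exact: lt_le_trans Cs.
  rewrite [RHS]integral_mkcond; apply: eq_integral => t _; rewrite patchE /g indicE.
  by rewrite in_setX/= [X in X && _]mem_set/= ?in_itv/= ?Cs//; case: (t \in _);
      rewrite ?mul1r ?mul0r.
rewrite (@integral_is_derive _ _ (fun s => a^-1 * ln s))//.
- by rewrite mulrBr.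
- move=> s; rewrite in_itv/= => /andP[Cs _].
  have s0 := lt_le_trans C0 Cs.
  apply: (is_derive_eq (is_deriveZ _ (is_derive1_ln s0))).
  by rewrite invfM.
- move=> s; rewrite in_itv/= => /andP[Cs _].
  have s0 := lt_le_trans C0 Cs.
  apply: (continuous_comp (f := fun s : R => a * s) (g := @GRing.inv R)).
    by apply: cvgM; [exact: cvg_cst|exact: cvg_id].
  by apply: inv_continuous; rewrite mulf_neq0 ?gt_eqF.
Qed.

End frullani.

(** * Null sets and independence *)

Section integral_complements.
Context d (T : measurableType d) {R : realType}.
Variable mu : {measure set T -> \bar R}.
Local Open Scope ereal_scope.

Lemma ge0_integral_conull (D : set T) (f : T -> \bar R) :
    measurable D -> mu (~` D) = 0 -> measurable_fun setT f ->
    (forall x, 0 <= f x) ->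
  \int[mu]_(x in D) f x = \int[mu]_x f x.
Proof.
move=> mD D0 mf f0.
by rewrite [RHS](ge0_negligible_integral _ _ _ _ D0)// ?setTD ?setCK//; exact: measurableC.
Qed.

Lemma ge0_integralB_EFin (D : set T) (f g : T -> R) (r s : R) :
    measurable D -> measurable_fun D f -> measurable_fun D g ->
    (forall x, D x -> (0 <= f x)%R) -> (forall x, D x -> (0 <= g x)%R) ->
    \int[mu]_(x in D) (f x)%:E = r%:E -> \int[mu]_(x in D) (g x)%:E = s%:E ->
  \int[mu]_(x in D) (f x - g x)%:E = (r - s)%:E.
Proof.
move=> mD mf mg f0 g0 fr gs.
have int_fin (h : T -> R) t : measurable_fun D h -> (forall x, D x -> (0 <= h x)%R) ->
    \int[mu]_(x in D) (h x)%:E = t%:E -> mu.-integrable D (EFin \o h).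
  move=> mh h0 ht; apply/integrableP; split; first exact/measurable_EFinP.
  rewrite (eq_integral (EFin \o h)) ?ht ?ltry// => x /[!inE] Dx.
  by rewrite /= ger0_norm// h0.
under eq_integral do rewrite EFinB.
rewrite integralB_EFin//; last 2 first.
- exact: int_fin fr.
- exact: int_fin gs.
by rewrite fr gs.
Qed.

End integral_complements.

Section thorin_sigma_finite.
Context {R : realType}.

(* On [[1/n, oo)] the integrand [ln (1 + x)] is bounded away from 0, so the
   measure is finite there. *)
Lemma sigma_finite_thorin (m : {measure set R -> \bar R}) :
  m `]-oo, 0]%classic = 0%E -> (thorin_integral m 1 < +oo)%E ->
  sigma_finite [set: R] m.
Proof.
move=> m0 moo.
pose D n : set R := `[n.+1%:R^-1, +oo[%classic.
have n0 n : 0 < n.+1%:R^-1 :> R by rewrite invr_gt0.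
(* The null half-line is added to every [D n] so that the union is all of [R]. *)
exists (fun n => `]-oo, 0]%classic `|` D n).
  apply/esym/seteqP; split => // x _.
  have [x0|x0] := leP x 0; first by exists 0%N => //; left; rewrite /= in_itv.
  have [n _ nx] := near_infty_natSinv_lt (PosNum x0).
  by exists n => //; right; rewrite /D/= in_itv/= andbT ltW//; apply: nx => /=.
have mln : measurable_fun setT (fun x : R => ln (1 + 1 * x)).
  by apply: (measurableT_comp (@measurable_ln R)); exact: measurable_funD.
have ln0 (x : R) : 0 < x -> 0 <= ln (1 + 1 * x).
  by move=> x0; rewrite ln_ge0// mul1r; lra.
move=> n; have mD : measurable (D n) by exact: measurable_itv.
split; first by apply: measurableU => //.
have c0 : 0 < ln (1 + n.+1%:R^-1 : R) by rewrite ln_gt0// ltrDl.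
suff mDn : (m (D n) < +oo)%E.
  apply: (@le_lt_trans _ _ (m `]-oo, 0%R]%classic + m (D n))%E).
    exact: measureU2.
  by rewrite m0 add0e.
have : ((ln (1 + n.+1%:R^-1))%:E * m (D n) <= thorin_integral m 1)%E.
  rewrite -integral_cst//.
  apply: (@le_trans _ _ (\int[m]_(x in D n) (ln (1 + 1 * x))%:E)%E).
    apply: ge0_le_integral => //.
    - by move=> x _; rewrite lee_fin ltW.
    - by apply/measurable_EFinP; exact: measurable_funTS.
    - move=> x; rewrite /D/= in_itv/= andbT => nx; rewrite lee_fin mul1r.
      by rewrite ler_ln ?posrE ?ltr_wpDl// ?lerD2l// (lt_le_trans (n0 n)).
  apply: ge0_subset_integral => //.
  - by apply/measurable_EFinP; exact: measurable_funTS.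
  - by move=> x; rewrite /= in_itv/= andbT lee_fin; exact: ln0.
  - by move=> x; rewrite /D/= !in_itv/= !andbT; exact: lt_le_trans (n0 n).
rewrite -lee_pdivlMl// => /le_lt_trans; apply.
by rewrite lte_mul_pinfty ?lee_fin ?invr_ge0 ?(ltW c0).
Qed.

End thorin_sigma_finite.

Section independence.
Context d (T : measurableType d) {R : realType} (P : probability T R).
Local Open Scope ereal_scope.

(** Independence says that the joint law agrees with the product measure on rectangles; the two are
    therefore equal, and Tonelli gives the iterated integral. *)
Lemma ge0_integral_independent (X Y : {RV P >-> R}) (h : R * R -> \bar R) :
    independent_RVs X Y -> measurable_fun setT h -> (forall z, 0 <= h z) ->
  \int[P]_w h (X w, Y w) =
  \int[distribution P X]_x \int[distribution P Y]_y h (x, y).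
Proof.
move=> XY mh h0.
have mZ : measurable_fun setT (fun w => (X w, Y w)) by exact: measurable_fun_pair.
pose PZ : {measure set (R * R) -> \bar R} :=
  pushforward_measure P mZ.
rewrite -(@fubini_tonelli1 _ _ _ _ _ (distribution P X) (distribution P Y) h)//.
rewrite (eq_measure_integral PZ); last first.
  by move=> A mA _; apply: product_measure_unique.
by rewrite /PZ/= ge0_integral_pushforward// preimage_setT.
Qed.

End independence.

(** * Ratios of stable variables *)

Section stable_laws.
Context {R : realType}.
Variables (alpha : R) (alpha01 : 0 < alpha < 1).

Let alpha0 : 0 < alpha. Proof. by have /andP[] := alpha01. Qed.

(* The mass of [(-oo, 0]] is at most [E[exp (- l S)] = exp (- l^alpha)]; let
   [l] tend to infinity. *)
Lemma stable_law_le0 (mu : probability R R) : is_stable_law alpha mu ->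
  mu `]-oo, 0]%classic = 0%E.
Proof.
move=> [_ lap]; have mN : measurable (`]-oo, 0]%classic : set R) by exact: measurable_itv.
have muN l : 0 <= l -> (mu `]-oo, 0%R]%classic <= (expR (- (l `^ alpha)))%:E)%E.
  move=> l0; rewrite -lap// /laplace -[leLHS]mul1e -integral_cst//.
  have me : measurable_fun setT (fun x : R => (expR (- (l * x)))%:E).
    apply/measurable_EFinP; apply: measurableT_comp => //.
    by apply: measurable_funN; exact: measurable_funM.
  apply: (@le_trans _ _ (\int[mu]_(x in `]-oo, 0%R]) (expR (- (l * x)))%:E)%E).
    apply: ge0_le_integral => //.
    - exact: measurable_funTS.
    - move=> x; rewrite /= in_itv/= => x0.
      by rewrite lee_fin -expR0 ler_expR oppr_ge0 mulr_ge0_le0.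
  apply: ge0_subset_integral => // x _; rewrite lee_fin; exact: expR_ge0.
have fN : mu `]-oo, 0%R]%classic \is a fin_num by exact: fin_num_measure.
apply/eqP; rewrite -(fineK fN) eqe eq_le fine_ge0 ?measure_ge0// andbT.
rewrite leNgt; apply/negP => r0; move: muN; rewrite -(fineK fN).
(* If the mass [r] were positive, this choice of [l] would give [l^alpha = |ln r| + 1 > - ln r],
   hence [exp (- l^alpha) < r]. *)
set r := fine _ in r0 *; move=> /(_ ((`|ln r| + 1) `^ alpha^-1) (powR_ge0 _ _)).
rewrite lee_fin -powRrM mulVf ?gt_eqF// powRr1 ?addr_ge0//.
apply/negP; rewrite -ltNge -[ltRHS]lnK ?posrE// ltr_expR.
by rewrite ltrNl (le_lt_trans (ler_norm _))// normrN ltrDl.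
Qed.

Context d (T : measurableType d) (P : probability T R) (S S' : {RV P >-> R}).
Hypotheses (hS : is_stable_law alpha (distribution P S))
  (hS' : is_stable_law alpha (distribution P S'))
  (hSS' : independent_RVs S S').

(** An almost sure event. Outside it [S'] may vanish or be negative, and the algebra of ratios and
    logarithms breaks down. *)
Let Omega : set T := S @^-1` `]0, +oo[ `&` S' @^-1` `]0, +oo[.

Let mOmega : measurable Omega.
Proof.
by apply: measurableI; rewrite -[X in measurable X]setTI; exact: measurable_funP.
Qed.

Let P_OmegaC : P (~` Omega) = 0%E.
Proof.
have N0 (Y : {RV P >-> R}) : is_stable_law alpha (distribution P Y) ->
    P (Y @^-1` `]-oo, 0]) = 0%E by move=> /stable_law_le0.
apply: (@subset_measure0 _ _ _ P _ (S @^-1` `]-oo, 0] `|` S' @^-1` `]-oo, 0])).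
- exact: measurableC.
- by apply: measurableU; rewrite -[X in measurable X]setTI; exact: measurable_funP.
- rewrite /Omega setCI => w [/negP|/negP] h; [left|right]; move: h;
    by rewrite /= !in_itv/= andbT -leNgt.
- apply/eqP; rewrite eq_le measure_ge0 andbT.
  apply: (@le_trans _ _ (P (S @^-1` `]-oo, 0%R]) + P (S' @^-1` `]-oo, 0%R]))%E).
    by apply: measureU2; rewrite -[X in measurable X]setTI; exact: measurable_funP.
  by rewrite !N0// adde0.
Qed.

Let integral_exp_combination (p q : R) : 0 <= p -> 0 <= q ->
  (\int[P]_(w in Omega) (expR (- (p * S w + q * S' w)))%:E =
   (expR (- (p `^ alpha + q `^ alpha)))%:E)%E.
Proof.
move=> p0 q0.
have me r : measurable_fun setT (fun x : R => (expR (- (r * x)))%:E).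
  apply/measurable_EFinP; apply: measurableT_comp => //.
  by apply: measurable_funN; exact: measurable_funM.
rewrite ge0_integral_conull//; last first.
  apply/measurable_EFinP; apply: measurableT_comp => //; apply: measurable_funN.
  by apply: measurable_funD; exact: measurable_funM.
pose h (z : R * R) : \bar R := ((expR (- (p * z.1)))%:E * (expR (- (q * z.2)))%:E)%E.
transitivity (\int[P]_w h (S w, S' w))%E.
  by apply: eq_integral => w _; rewrite /h/= -EFinM -expRD opprD.
rewrite (ge0_integral_independent hSS'); last 2 first.
- apply: emeasurable_funM; [exact: (measurableT_comp (me p))|exact: (measurableT_comp (me q))].
- by move=> z; rewrite mule_ge0// lee_fin expR_ge0.
transitivity (\int[distribution P S]_x
    ((expR (- (p * x)))%:E * (expR (- (q `^ alpha)))%:E))%E.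
  apply: eq_integral => x _; rewrite /h/= ge0_integralZl//.
  by rewrite -/(laplace (distribution P S') q) hS'.2.
rewrite ge0_integralZr//.
by rewrite -/(laplace (distribution P S) p) hS.2// -EFinM -expRD opprD.
Qed.

Let ratio_odds (y b : R) (w : T) : Omega w -> 0 < y -> y <= b ->
  [/\ 0 < S w, 0 < S' w, 0 < S' w + y * S w & S' w + y * S w <= S' w + b * S w].
Proof.
move=> []; rewrite /= !in_itv/= !andbT => Sw S'w y0 yb; split => //.
  by rewrite addr_gt0// mulr_gt0.
by rewrite lerD2l ler_pM2r.
Qed.

(* Frullani's formula, with exponent 1, writes the logarithm as an integral of
   exponentials, whose expectations are known; a second use of the formula,
   with exponent [alpha], evaluates the result. *)
Let integral_log_ratio (y b : R) : 0 < y -> y < b ->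
  (\int[P]_(w in Omega) (ln (S' w + b * S w) - ln (S' w + y * S w))%:E =
   (alpha^-1 * (ln (1 + b `^ alpha) - ln (1 + y `^ alpha)))%:E)%E.
Proof.
move=> y0 yb.
pose e (q t : R) w : R := expR (- (t * q * S w + t * S' w)).
(* The indicator confines the integrand to [Omega] and [t > 0], where [y < b] makes it nonnegative,
   as Tonelli requires. *)
pose k (z : T * R) : \bar R :=
  (\1_(Omega `*` `]0%R, +oo[) z * ((e y z.2 z.1 - e b z.2 z.1) / z.2))%:E.
have k0 z : (0 <= k z)%E.
  rewrite lee_fin /k indicE; case: (boolP (z \in _)) => [|_]; last by rewrite mul0r.
  rewrite inE => -[/= Oz]; rewrite in_itv/= andbT => t0; rewrite mul1r.
  have [S0 S'0 _ _] := ratio_odds Oz y0 (ltW yb).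
  by rewrite divr_ge0 ?(ltW t0)// subr_ge0 ler_expR lerN2 lerD2r ler_pM2r// ler_pM2l// ltW.
have me q : measurable_fun [set: T * R] (fun z => e q z.2 z.1).
  apply: measurableT_comp => //; apply: measurable_funN.
  apply: measurable_funD; apply: measurable_funM.
  - exact: measurable_funM.
  - exact: measurableT_comp.
  - by [].
  - exact: measurableT_comp.
have mk : measurable_fun [set: T * R] k.
  apply/measurable_EFinP; apply: measurable_funM.
    by apply: measurable_indic; exact: measurableX.
  apply: measurable_funM; first exact: measurable_funB.
  exact: (measurableT_comp measurable_invr).
transitivity (\int[P]_w \int[lebesgue_measure]_t k (w, t))%E.
  rewrite integral_mkcond; apply: eq_integral => w _; rewrite patchE.
  case: ifPn => [|/negP Ow]; last first.
    rewrite integral0_eq// => t _; rewrite /k indicE memNset ?mul0r// => -[]/=.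
    by move=> /mem_set.
  rewrite inE => Ow; have [S0 S'0 Cy yCb] := ratio_odds Ow y0 (ltW yb).
  (* The factor 1 is written [1^-1] to match the constant [a^-1] of [frullani_powR] at exponent
     [a = 1]. *)
  rewrite -[ln _ - _]mul1r -{1}invr1 -frullani_powR//; last first.
    by rewrite ltrD2l ltr_pM2r.
  rewrite integral_mkcond; apply: eq_integral => t _; rewrite patchE /k indicE in_setX/=.
  rewrite (mem_set Ow)/=; case: ifPn; rewrite ?mul0r// mul1r inE/= in_itv/= andbT => t0.
  by rewrite powRr1 ?(ltW t0)// /e; congr ((expR _ - expR _) / _)%:E; ring.
rewrite (@fubini_tonelli _ _ _ _ _ P lebesgue_measure k)//.
(* By this homogeneity the expectation of [exp (- t (q S + S'))] is [exp (- (1 + q^alpha) t^alpha)],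
   the form needed for Frullani's formula with exponent [alpha]. *)
have scale q t : 0 < t -> 0 < q ->
    (t * q) `^ alpha + t `^ alpha = (1 + q `^ alpha) * t `^ alpha.
  by move=> t0 q0; rewrite powRM ?ltW//; ring.
transitivity (\int[lebesgue_measure]_(t in `]0%R, +oo[)
   ((expR (- ((1 + y `^ alpha) * t `^ alpha)) -
     expR (- ((1 + b `^ alpha) * t `^ alpha))) / t)%:E)%E; last first.
  rewrite frullani_powR//; first by rewrite ltr_pwDl// powR_ge0.
  by rewrite ltrD2l gt0_ltr_powR ?nnegrE ?(ltW y0)// ltW// (lt_trans y0).
rewrite [RHS]integral_mkcond; apply: eq_integral => t _; rewrite patchE.
case: ifPn => [|/negP t0]; last first.
  rewrite integral0_eq// => w _; rewrite /k indicE memNset ?mul0r// => -[]/= _.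
  by move=> /mem_set.
rewrite inE/= in_itv/= andbT => t0.
transitivity (\int[P]_(w in Omega) ((e y t w - e b t w)%:E * (t^-1)%:E))%E.
  rewrite [RHS]integral_mkcond; apply: eq_integral => w _; rewrite patchE /k indicE in_setX/=.
  rewrite [X in _ && X]mem_set/= ?in_itv/= ?t0// andbT.
  by case: (w \in _); rewrite ?mul1r ?mul0r.
have met q : measurable_fun Omega (e q t).
  apply: measurable_funTS; apply: measurableT_comp => //; apply: measurable_funN.
  by apply: measurable_funD; apply: measurable_funM.
rewrite ge0_integralZr//; last 3 first.
- by apply/measurable_EFinP; exact: measurable_funB.
- move=> w Ow; have [S0 _ _ _] := ratio_odds Ow y0 (ltW yb).
  by rewrite lee_fin subr_ge0 ler_expR lerN2 lerD2r ler_pM2r// ler_pM2l// ltW.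
- by rewrite lee_fin invr_ge0 ltW.
have b0 := lt_trans y0 yb.
rewrite (ge0_integralB_EFin mOmega _ _ _ _ (integral_exp_combination _ _)
  (integral_exp_combination _ _)) ?mulr_ge0 ?ltW//.
- by rewrite -EFinM !scale.
- exact: met.
- exact: met.
Qed.

Variables (X : {RV P >-> R}).
Hypothesis hX : forall B, measurable B ->
  distribution P X B = P [set w | B (S w / S' w)].

Let measurable_ratio : measurable_fun setT (fun w => S w / S' w).
Proof.
by apply: measurable_funM => //; exact: (measurableT_comp measurable_invr).
Qed.

Lemma stable_ratio_le0 : distribution P X `]-oo, 0]%classic = 0%E.
Proof.
rewrite hX//; apply: (subset_measure0 _ _ _ P_OmegaC).
- by rewrite -[X in measurable X]setTI; exact: measurable_ratio.
- exact: measurableC.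
- move=> w /=; rewrite in_itv/= => SS' [/=]; rewrite !in_itv/= !andbT => S0 S'0.
  by move: SS'; rewrite leNgt divr_gt0.
Qed.

(** For [x = s / s'] one has [1 + l y x / (1 + y x) = (s' + (1 + l) y s) / (s' + y s)], so this is
    [integral_log_ratio] with [b = (1 + l) y]. The case [l = 0] is separate because that result
    needs [y < b]. *)
Lemma integral_log_stable_ratio (y l : R) : 0 < y -> 0 <= l ->
  (\int[distribution P X]_(x in `]0%R, +oo[) (ln (1 + l * to_odds_fraction y x))%:E =
   (alpha^-1 * (ln (1 + ((1 + l) * y) `^ alpha) - ln (1 + y `^ alpha)))%:E)%E.
Proof.
move=> y0; rewrite le_eqVlt => /predU1P[<-|l0].
  rewrite addr0 mul1r subrr mulr0 integral0_eq// => x _.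
  by rewrite mul0r addr0 ln1.
rewrite -integral_log_ratio ?ltr_pMl ?ltrDl//.
pose PX : {measure set R -> \bar R} :=
  pushforward_measure P measurable_ratio.
rewrite (eq_measure_integral PX); last by move=> A mA _; exact: hX.
have mln : measurable_fun setT (fun x => (ln (1 + l * to_odds_fraction y x))%:E).
  apply/measurable_EFinP; apply: (measurableT_comp (@measurable_ln R)).
  by apply: measurable_funD => //; exact: measurable_funM.
have oddsE s s' : 0 < s -> 0 < s' -> 1 + l * to_odds_fraction y (s / s') =
    (s' + (1 + l) * y * s) / (s' + y * s).
  move=> s0 s'0; rewrite /to_odds_fraction; field.
  by rewrite !gt_eqF ?addr_gt0 ?mulr_gt0// divr_gt0.
have odds0 (x : R) : 0 < x -> 0 <= to_odds_fraction y x.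
  by move=> x0; rewrite divr_ge0 ?addr_ge0 ?mulr_ge0 ?ltW.
rewrite /PX/= ge0_integral_pushforward//; last 2 first.
- exact: measurable_funTS.
- move=> x; rewrite inE/= in_itv/= andbT => x0.
  by rewrite lee_fin ln_ge0// lerDl mulr_ge0 ?odds0// ltW.
set D := _ @^-1` _.
have DE : D `\` (~` Omega) = Omega.
  rewrite setDE setCK; apply/seteqP; split => w; first by case.
  move=> Ow; split => //; have [/= S0 S'0] := Ow; move: S0 S'0.
  by rewrite /D/= !in_itv/= !andbT => S0 S'0; exact: divr_gt0.
have mD : measurable D.
  by rewrite -[X in measurable X]setTI; apply: measurable_ratio => //; exact: measurable_itv.
rewrite (@ge0_negligible_integral _ _ _ _ _ (~` Omega))//; first last.
- move=> w; rewrite /D/= in_itv/= andbT => w0.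
  by rewrite lee_fin ln_ge0// lerDl mulr_ge0 ?odds0// ltW.
- by apply: measurable_funTS; exact: (measurableT_comp mln).
- exact: measurableC.
rewrite DE; apply: eq_integral => w; rewrite inE => -[]/=.
rewrite !in_itv/= !andbT => S0 S'0.
by rewrite oddsE// ln_div// posrE addr_gt0// !mulr_gt0// addr_gt0.
Qed.

End stable_laws.

(** * Gamma variables *)

Section gamma_mixtures.
Context {R : realType}.

Lemma probability_conull d (T : measurableType d) (P : probability T R) (D : set T) :
  measurable D -> P (~` D) = 0%E <-> P D = 1%E.
Proof.
move=> mD; split => [D0|D1].
  by rewrite -[D in LHS]setCK probability_setC ?D0 ?sube0//; exact: measurableC.
by rewrite probability_setC// D1 subee.
Qed.

(* [R] and [measurableTypeR R] carry the same sigma-algebra, but under different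
   displays; the identity transports measures from the former to the latter. *)
Lemma integral_has_density (mu : {measure set R -> \bar R}) (f : R -> R)
    (h : R -> \bar R) :
    has_density mu f -> measurable_fun setT h -> (forall x, (0 <= h x)%E) ->
  (\int[mu]_x h x = \int[lebesgue_measure]_x ((f x)%:E * h x))%E.
Proof.
move=> [mf f0 muE] mh h0.
have mid : @measurable_fun _ _ R (measurableTypeR R) setT idfun by move=> _ B mB; rewrite setTI.
pose m : {measure set (measurableTypeR R) -> \bar R} :=
  pushforward_measure mu mid.
rewrite -(@ge0_integral_density _ _ _ lebesgue_measure m f)//.
by rewrite /m/= [RHS]ge0_integral_pushforward// preimage_setT.
Qed.

(* With [b = 1 + l], one has
   [exp (- l x) gamma_pdf s x = b^(1 - s) gamma_pdf s (b x)] for [x > 0]. *)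
Lemma laplace_gamma (g : probability R R) (s l : R) :
  has_density g (gamma_pdf s) -> 0 <= l -> laplace g l = ((1 + l) `^ (- s))%:E.
Proof.
move=> hg l0; have [mg g0 gE] := hg; have b0 : 0 < 1 + l by lra.
have ml : measurable_fun setT (fun x => (expR (- (l * x)))%:E).
  apply/measurable_EFinP; apply: measurableT_comp => //.
  by apply: measurable_funN; exact: measurable_funM.
have gT : (\int[lebesgue_measure]_x (gamma_pdf s x)%:E = 1)%E.
  by rewrite -gE// probability_setT.
rewrite /laplace (integral_has_density hg)//.
pose I := (\int[lebesgue_measure]_x (gamma_pdf s ((1 + l) * x))%:E)%E.
(* The normalisation comes from [g] being a probability; scaling its total mass by [1 + l]
   determines [I]. *)
have I1 : ((1 + l)%:E * I = 1)%E.
  rewrite /I -(@ge0_integral_scale _ _ (fun x => (gamma_pdf s x)%:E))//.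
  exact/measurable_EFinP.
transitivity (((1 + l) `^ (1 - s))%:E * I)%E.
  rewrite -ge0_integralZl//; last 3 first.
  - apply/measurable_EFinP; apply: measurableT_comp => //; exact: measurable_funM.
  - by move=> x _; rewrite lee_fin.
  - by rewrite lee_fin powR_ge0.
  apply: eq_integral => x _; rewrite -!EFinM /gamma_pdf pmulr_rgt0//.
  case: ifPn => [x0|_]; last by rewrite mul0r mulr0.
  congr EFin; rewrite powRM ?ltW//.
  have -> : (1 + l) `^ (1 - s) = ((1 + l) `^ (s - 1))^-1 by rewrite -powRN opprB.
  have -> : - ((1 + l) * x) = - x - l * x by ring.
  rewrite expRD; move: (Gamma_fun s)^-1 => iG; field.
  by rewrite gt_eqF// powR_gt0.
have -> : I = ((1 + l)^-1)%:E.
  by rewrite -[RHS]mule1 -I1 muleA -EFinM mulVf ?gt_eqF// mul1e.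
rewrite -EFinM -(powR_inv1 (ltW b0)) -powRD ?(gt_eqF b0) ?implybT//.
by congr (_ `^ _)%:E; ring.
Qed.

Lemma GGC_gamma_M_law d (T : measurableType d) (P : probability T R) (s : R)
    (nu : {measure set R -> \bar R}) (A G L : {RV P >-> R}) :
    is_M_law s nu (distribution P A) ->
    has_density (distribution P G) (gamma_pdf s) -> independent_RVs G A ->
    (forall B, measurable B -> distribution P L B = P [set w | B (G w * A w)]) ->
  is_GGC s nu (distribution P L).
Proof.
move=> [thnu A1 csA] hG hGA hL.
have mA0 : measurable (`[0, +oo[%classic : set R) by exact: measurable_itv.
have A0 := (probability_conull (distribution P A) mA0).2 A1.
(* [A] is put first so that in the iterated integral [G] is integrated out with [A] fixed. *)
have AG : independent_RVs A G by move=> B C mB mC; rewrite setIC hGA// muleC.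
have mGA : measurable_fun setT (fun w => G w * A w) by exact: measurable_funM.
have G0 : distribution P G `]-oo, 0]%classic = 0%E.
  have [_ _ ->//] := hG; rewrite integral0_eq// => x /=; rewrite in_itv/= => x0.
  by rewrite /gamma_pdf ltNge x0.
split => //.
- apply/(probability_conull (distribution P L) mA0).
  apply: etrans (hL _ (measurableC mA0)) _.
  apply: (@subset_measure0 _ _ _ P _ (G @^-1` `]-oo, 0] `|` A @^-1` (~` `[0, +oo[))).
  + rewrite -[X in measurable X]setTI; apply: mGA => //; exact: measurableC.
  + by apply: measurableU; rewrite -[X in measurable X]setTI;
      apply: measurable_funP => //; exact: measurableC.
  + move=> w /=; rewrite !in_itv/= !andbT => GA.
    have [G0w|G0w] := leP (G w) 0; first by left.
    by right=> A0w; apply: GA; rewrite mulr_ge0// ltW.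
  + apply/eqP; rewrite eq_le measure_ge0 andbT.
    apply: (@le_trans _ _ (P (G @^-1` `]-oo, 0%R]) + P (A @^-1` (~` `[0%R, +oo[)))%E).
      by apply: measureU2; rewrite -[X in measurable X]setTI;
        apply: measurable_funP => //; exact: measurableC.
    by rewrite [X in (X + _)%E]G0 [X in (_ + X)%E]A0 adde0.
- move=> l l0; rewrite -csA//.
  pose h (z : R * R) : \bar R := (expR (- (l * (z.2 * z.1))))%:E.
  have mh : measurable_fun setT h.
    apply/measurable_EFinP; apply: measurableT_comp => //; apply: measurable_funN.
    by apply: measurable_funM => //; exact: measurable_funM.
  have h0 z : (0 <= h z)%E by rewrite lee_fin expR_ge0.
  pose PL : {measure set R -> \bar R} :=
    pushforward_measure P mGA.
  have ml : measurable_fun setT (fun x => (expR (- (l * x)))%:E).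
    apply/measurable_EFinP; apply: measurableT_comp => //.
    by apply: measurable_funN; exact: measurable_funM.
  rewrite /laplace (eq_measure_integral PL); last by move=> B mB _; exact: hL.
  rewrite /PL/= ge0_integral_pushforward// preimage_setT.
  transitivity (\int[P]_w h (A w, G w))%E => //.
  rewrite ge0_integral_independent//.
  (* [laplace_gamma] applies at [l * x] only when this is nonnegative, so the null set of negative
     [x] is removed on both sides. *)
  rewrite -(ge0_integral_conull mA0 A0); last 2 first.
  + exact: measurable_fun_fubini_tonelli_F.
  + by move=> x; apply: integral_ge0.
  rewrite /cauchy_stieltjes -[RHS](ge0_integral_conull mA0 A0); last 2 first.
  + apply/measurable_EFinP; apply: (measurableT_comp (measurable_powR _)).
    by apply: measurable_funD => //; exact: measurable_funM.
  + by move=> x; rewrite lee_fin powR_ge0.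
  apply: eq_integral => x; rewrite inE/= in_itv/= andbT => x0.
  rewrite -(laplace_gamma hG) ?mulr_ge0//.
  by apply: eq_integral => y _; rewrite /h/=; congr (expR _)%:E; ring.
Qed.

End gamma_mixtures.

(** * Thorin measures *)

Section thorin_images.
Context {R : realType}.
Variables (nu : {measure set R -> \bar R}) (hnu : thorin nu).

Lemma measurable_ln1M (l : R) : measurable_fun setT (fun x : R => ln (1 + l * x)).
Proof.
apply: (measurableT_comp (@measurable_ln R)).
by apply: measurable_funD => //; exact: measurable_funM.
Qed.

Lemma to_odds_fraction_gt0 (a x : R) : 0 < a -> 0 < x -> 0 < to_odds_fraction a x.
Proof. by move=> a0 x0; rewrite divr_gt0 ?ltr_pwDl// ?mulr_gt0// ltW// mulr_gt0. Qed.

Lemma thorin_integralE (l : R) : 0 <= l ->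
  thorin_integral nu l = (thorin_exponent nu l)%:E.
Proof.
move=> l0; rewrite /thorin_exponent fineK//.
have I0 : (0 <= thorin_integral nu l)%E.
  apply: integral_ge0 => x; rewrite /= in_itv/= andbT => x0.
  by rewrite lee_fin ln_ge0// lerDl mulr_ge0// ltW.
move: l0; rewrite le_eqVlt => /predU1P[<-|l0].
  rewrite /thorin_integral integral0_eq// => x _.
  by rewrite mul0r addr0 ln1.
by rewrite ge0_fin_numE//; have [_ _] := hnu; apply.
Qed.

Lemma thorin_integralB (a K : R) : 0 < a -> 1 <= K ->
  (\int[nu]_(r in `]0%R, +oo[) (ln (1 + K * a * r) - ln (1 + a * r))%:E =
   (thorin_exponent nu (K * a) - thorin_exponent nu a)%:E)%E.
Proof.
move=> a0 K1; have Ka0 : 0 <= K * a by rewrite mulr_ge0 ?ltW// (lt_le_trans ltr01).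
apply: ge0_integralB_EFin => //.
- by apply: measurable_funTS; exact: measurable_ln1M.
- by apply: measurable_funTS; exact: measurable_ln1M.
- move=> x; rewrite /= in_itv/= andbT => x0.
  by rewrite ln_ge0// lerDl mulr_ge0// ltW.
- move=> x; rewrite /= in_itv/= andbT => x0.
  by rewrite ln_ge0// lerDl mulr_ge0// ltW.
- exact: thorin_integralE.
- by apply: thorin_integralE; rewrite ltW.
Qed.

Lemma thorin_integral_thorin_image (a l : R) : 0 < a -> 0 <= l ->
  thorin_integral (thorin_image a nu) l =
  (thorin_exponent nu ((1 + l) * a) - thorin_exponent nu a)%:E.
Proof.
move=> a0 l0; rewrite -thorin_integralB ?lerDl//.
have [nu0 _ _] := hnu.
have m0oo : measurable (`]0, +oo[%classic : set R) by exact: measurable_itv.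
rewrite /thorin_integral (ge0_integral_pushforward (measurable_to_odds_fraction a))//;
  last 2 first.
- apply/measurable_EFinP; apply: measurable_funTS; exact: measurable_ln1M.
- move=> x; rewrite inE/= in_itv/= andbT => x0.
  by rewrite lee_fin ln_ge0// lerDl mulr_ge0// ltW.
set D := _ @^-1` _.
(* [D] also contains every [r < - 1/a], where numerator and denominator of the fraction are both
   negative; [nu] does not charge these points. *)
have DE : D `\` `]-oo, 0]%classic = `]0, +oo[%classic.
  apply/seteqP; split => r /=.
    by move=> [_]; rewrite !in_itv/= andbT => /negP; rewrite -ltNge.
  rewrite in_itv/= andbT => r0; split; last by rewrite in_itv/= leNgt r0.
  by rewrite /D/= in_itv/= andbT to_odds_fraction_gt0.
have mD : measurable D.
  by rewrite -[X in measurable X]setTI; exact: measurable_to_odds_fraction.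
rewrite (ge0_negligible_integral _ _ _ _ nu0)//; last 2 first.
- apply/measurable_EFinP; apply: measurable_funTS.
  exact: (measurableT_comp (measurable_ln1M l) (measurable_to_odds_fraction a)).
- move=> r; rewrite /D/= in_itv/= andbT => r0.
  by rewrite lee_fin ln_ge0// lerDl mulr_ge0// ltW.
rewrite DE; apply: eq_integral => r; rewrite inE/= in_itv/= andbT => r0.
have ar0 := mulr_gt0 a0 r0.
rewrite -ln_div ?posrE; first last.
- by rewrite ltr_pwDl// ltW.
- by rewrite ltr_pwDl// ltW// -mulrA mulr_gt0// ltr_pwDl.
rewrite /= /to_odds_fraction; congr (ln _)%:E; field.
by rewrite gt_eqF// ltr_pwDl// ltW.
Qed.

(** The image of a sigma-finite measure need not be sigma-finite; here this follows from the finite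
    Thorin integral at [l = 1]. *)
Lemma thorin_thorin_image (a : R) : 0 < a ->
  thorin [the {measure set R -> \bar R} of thorin_image a nu].
Proof.
move=> a0; have [nu0 _ _] := hnu.
have im0 : thorin_image a nu `]-oo, 0]%classic = 0%E.
  apply: (subset_measure0 _ _ _ nu0) => //.
    by rewrite -[X in measurable X]setTI; exact: measurable_to_odds_fraction.
  move=> r /=; rewrite !in_itv/= => ar; rewrite leNgt; apply/negP => r0.
  by move: ar; rewrite leNgt to_odds_fraction_gt0.
split => //.
- apply: sigma_finite_thorin => //.
  by rewrite [X in (X < _)%E]thorin_integral_thorin_image// ltry.
- by move=> l l0; rewrite [X in (X < _)%E]thorin_integral_thorin_image ?ltW// ltry.
Qed.

End thorin_images.

(** * The Thorin measure [Lambda_(alpha,nu)] *)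

Section Lambda_mixture.
Context {R : realType}.
Variables (alpha c : R) (alpha01 : 0 < alpha < 1) (c0 : 0 < c).
Variables (nu : {measure set R -> \bar R}) (hnu : thorin nu).
Variable chi : probability R R.
Hypothesis chi0 : chi `]-oo, 0]%classic = 0%E.
Hypothesis chi_ln : forall y l : R, 0 < y -> 0 <= l ->
  (\int[chi]_(x in `]0%R, +oo[) (ln (1 + l * to_odds_fraction y x))%:E =
   (alpha^-1 * (ln (1 + ((1 + l) * y) `^ alpha) - ln (1 + y `^ alpha)))%:E)%E.

Local Notation a := (c `^ alpha).
Local Notation Lambda := [the {measure set R -> \bar R} of Lambda_mix alpha c chi nu].

Let scale (r : R) : R := (p_alpha alpha c r / (1 - p_alpha alpha c r)) `^ alpha^-1.

Let a0 : 0 < a. Proof. exact: powR_gt0. Qed.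

Let scaleE r : 0 < r -> scale r = (a * r) `^ alpha^-1.
Proof.
move=> r0; have ar0 := mulr_gt0 a0 r0.
rewrite /scale /p_alpha /to_odds_fraction; congr (_ `^ _); field.
by rewrite gt_eqF//= ?ltr_pwDl ?(ltW ar0)//; apply/eqP; lra.
Qed.

Let scale_gt0 r : 0 < r -> 0 < scale r.
Proof. by move=> r0; rewrite scaleE// powR_gt0// mulr_gt0. Qed.

Let measurable_scale : measurable_fun setT scale.
Proof.
apply: (measurableT_comp (measurable_powR _)).
have mp : measurable_fun [set: R] (p_alpha alpha c).
  exact: measurable_to_odds_fraction.
apply: measurable_funM => //; apply: (measurableT_comp measurable_invr).
exact: measurable_funB.
Qed.

Let measurable_Lambda_law U : measurable U ->
  measurable_fun setT (fun r => Lambda_law alpha chi (p_alpha alpha c r) U).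
Proof.
move=> mU; pose g (z : R * R) := to_odds_fraction (scale z.1) z.2.
have mg : measurable_fun setT g.
  have mh : measurable_fun [set: R * R] (fun z : R * R => (scale z.1, z.2)).
    apply: measurable_fun_pair => //.
    exact: (measurableT_comp measurable_scale measurable_fst).
  exact: (measurableT_comp measurable_to_odds_fraction2 mh).
rewrite (_ : (fun _ => _) = fubini_F chi (fun z => (\1_U (g z))%:E)).
  apply: measurable_fun_fubini_tonelli_F => //.
  apply/measurable_EFinP; apply: measurableT_comp => //.
apply/funext => r; rewrite /fubini_F/=.
transitivity (\int[chi]_y (\1_(to_odds_fraction (scale r) @^-1` U) y)%:E)%E => //.
rewrite integral_indic ?setIT//.
by rewrite -[X in measurable X]setTI; exact: measurable_to_odds_fraction.
Qed.

(** With [y = scale r], [chi_ln] evaluates the integral over each component. Since [y^alpha = a r],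
    the result is [alpha^-1] times [ln (1 + (1 + l)^alpha a r) - ln (1 + a r)], which
    [thorin_integralB] integrates against [nu]. *)
Lemma thorin_integral_Lambda_mix (l : R) : 0 <= l ->
  thorin_integral Lambda l =
  (alpha^-1 * (thorin_exponent nu ((1 + l) `^ alpha * a) - thorin_exponent nu a))%:E.
Proof.
move=> l0; have /andP[alpha0 _] := alpha01.
have K1 : 1 <= (1 + l) `^ alpha.
  by rewrite -[leLHS](powRr0 (1 + l)) ler_powR ?lerDl// ltW.
(* The cut at 0 makes the integrand nonnegative on all of [R], as the mixture formula requires;
   [ln (1 + l u)] can be negative for [u < 0]. *)
pose f : R -> \bar R := (fun u => (ln (1 + l * u))%:E) \_ `]0%R, +oo[.
have f0 x : (0 <= f x)%E.
  apply: erestrict_ge0 => u; rewrite /= in_itv/= andbT => u0.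
  by rewrite lee_fin ln_ge0// lerDl mulr_ge0// ltW.
have mf : measurable_fun setT f.
  apply/(measurable_restrictT (fun u => (ln (1 + l * u))%:E)) => //.
  by apply/measurable_EFinP; apply: measurable_funTS; exact: measurable_ln1M.
rewrite /thorin_integral integral_mkcond -/f.
rewrite (ge0_integral_mixture (nu := nu) (D := `]0%R, +oo[%classic)
  (k := fun r => Lambda_law alpha chi (p_alpha alpha c r)))//.
rewrite EFinM -thorin_integralB// -ge0_integralZl//; first last.
- by rewrite lee_fin invr_ge0 ltW.
- move=> r; rewrite /= in_itv/= andbT => r0; rewrite lee_fin subr_ge0.
  have ar0 := mulr_gt0 a0 r0.
  rewrite ler_ln ?posrE ?lerD2l -?mulrA ?ler_peMl ?(ltW ar0)// ltr_pwDl// ?(ltW ar0)//.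
  by rewrite mulr_ge0 ?powR_ge0// ltW.
- apply/measurable_EFinP; apply: measurable_funTS.
  by apply: measurable_funB; exact: measurable_ln1M.
apply: eq_integral => r; rewrite inE/= in_itv/= andbT => r0.
rewrite ge0_integral_distribution// -(@ge0_integral_conull _ _ _ chi `]0%R, +oo[%classic)//;
  last 3 first.
- rewrite -[RHS]chi0; congr (chi _).
  by apply/seteqP; split => x /=; rewrite !in_itv/= andbT leNgt => /negP.
- by apply: measurableT_comp => //; exact: measurable_to_odds_fraction.
- by move=> x; exact: f0.
transitivity (\int[chi]_(x in `]0%R, +oo[) (ln (1 + l * to_odds_fraction (scale r) x))%:E)%E.
  apply: eq_integral => x; rewrite inE/= in_itv/= andbT => x0.
  by rewrite /f/= patchE mem_set//= in_itv/= andbT to_odds_fraction_gt0// scale_gt0.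
rewrite chi_ln ?scale_gt0// -EFinM.
have scalea : scale r `^ alpha = a * r.
  by rewrite scaleE// -powRrM mulVf ?gt_eqF// powRr1// ltW// mulr_gt0.
rewrite powRM ?scalea ?ltW ?scale_gt0 ?mulrA//; lra.
Qed.

Lemma thorin_Lambda_mix : thorin Lambda.
Proof.
have L0 : Lambda `]-oo, 0]%classic = 0%E.
  rewrite /= /Lambda_mix integral0_eq// => r; rewrite /= in_itv/= andbT => r0.
  apply: (subset_measure0 _ _ _ chi0) => //.
    by rewrite -[X in measurable X]setTI; exact: measurable_to_odds_fraction.
  move=> x /=; rewrite !in_itv/= => ar; rewrite leNgt; apply/negP => x0.
  by move: ar; rewrite leNgt to_odds_fraction_gt0// scale_gt0.
split => //.
- by apply: sigma_finite_thorin => //; rewrite thorin_integral_Lambda_mix// ltry.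
- by move=> l l0; rewrite thorin_integral_Lambda_mix ?ltW// ltry.
Qed.

End Lambda_mixture.

(** * The law of xi *)

Section tilted_law.
Context {R : realType}.
Variables (theta a : R) (a0 : 0 < a).
Variables (nu : {measure set R -> \bar R}) (mu : probability R R).
Hypothesis hmu : is_M_law theta nu mu.

Local Notation Psi := (thorin_exponent nu).

Let measurable_0y : measurable (`[0, +oo[%classic : set R).
Proof. exact: measurable_itv. Qed.

Lemma M_law_lt0 : mu (~` `[0, +oo[%classic) = 0%E.
Proof. by have [_ /probability_conull ->] := hmu. Qed.

Lemma cauchy_stieltjes_M_law l : 0 <= l ->
  cauchy_stieltjes theta mu l = (expR (- (theta * Psi l)))%:E.
Proof. by have [_ _] := hmu; apply. Qed.

Lemma kappaE : kappa theta a mu = expR (theta * Psi a).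
Proof. by rewrite /kappa cauchy_stieltjes_M_law ?(ltW a0)//= expRN invrK. Qed.

Lemma measurable_cauchy_stieltjes s l :
  measurable_fun setT (fun x : R => ((1 + l * x) `^ (- s))%:E).
Proof.
apply/measurable_EFinP; apply: (measurableT_comp (measurable_powR _)).
by apply: measurable_funD => //; exact: measurable_funM.
Qed.

Let measurable_weight :
  measurable_fun setT (fun u : R => kappa theta a mu * (1 - u) `^ theta).
Proof.
apply: measurable_funM => //; apply: (measurableT_comp (measurable_powR _)).
exact: measurable_funB.
Qed.

Let weight_ge0 u : 0 <= kappa theta a mu * (1 - u) `^ theta.
Proof. by rewrite mulr_ge0 ?powR_ge0// kappaE expR_ge0. Qed.

Variable q : probability R R.
Hypothesis hq : forall B, measurable B -> q B = Q_law theta a mu B.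

Let integral_Q_law (f : R -> \bar R) :
    measurable_fun setT f -> (forall u, (0 <= f u)%E) ->
  (\int[q]_u f u = \int[mu]_(x in `[0%R, +oo[)
    ((kappa theta a mu * (1 + a * x) `^ (- theta))%:E * f (to_odds_fraction a x)))%E.
Proof.
move=> mf f0.
rewrite (ge0_integral_density (mu := Q_tilde a mu) measurable_weight weight_ge0)//.
have mg : measurable_fun setT
    (fun u : R => ((kappa theta a mu * (1 - u) `^ theta)%:E * f u)%E).
  by apply: emeasurable_funM => //; exact/measurable_EFinP.
have g0 (u : R) : (0 <= (kappa theta a mu * (1 - u) `^ theta)%:E * f u)%E.
  by rewrite mule_ge0// lee_fin.
rewrite [LHS](ge0_integral_distribution _ mg g0).
rewrite -(ge0_integral_conull measurable_0y M_law_lt0 (measurableT_comp mg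
  (measurable_to_odds_fraction a)) (fun x => g0 (to_odds_fraction a x))).
apply: eq_integral => x; rewrite inE/= in_itv/= andbT => x0.
have ax0 : 0 < 1 + a * x by rewrite ltr_pwDl// mulr_ge0// ltW.
have -> : 1 - to_odds_fraction a x = (1 + a * x)^-1.
  by rewrite /to_odds_fraction; field; rewrite gt_eqF.
by rewrite -(powR_inv1 (ltW ax0)) -powRrM mulN1r.
Qed.

(** For [u = a x / (1 + a x)] the product [(1 + a x) (1 - u + u K)] is [1 + K a x], so the weight
    and the integrand merge into a single power. Both factors are nonnegative for [x >= 0], which
    allows the powers to be multiplied. *)
Lemma integral_tilted_law (K : R) : 1 <= K ->
  (\int[q]_u ((1 - u + u * K) `^ (- theta))%:E =
   (kappa theta a mu)%:E * cauchy_stieltjes theta mu (K * a))%E.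
Proof.
move=> K1.
rewrite integral_Q_law; last 2 first.
- apply/measurable_EFinP; apply: (measurableT_comp (measurable_powR _)).
  by apply: measurable_funD; [exact: measurable_funB|exact: measurable_funM].
- by move=> u; rewrite lee_fin powR_ge0.
rewrite /cauchy_stieltjes -(ge0_integral_conull measurable_0y M_law_lt0); last 2 first.
- exact: measurable_cauchy_stieltjes.
- by move=> x; rewrite lee_fin powR_ge0.
have kappa0 : 0 <= kappa theta a mu by rewrite kappaE expR_ge0.
rewrite -[RHS]ge0_integralZl; first last.
- by rewrite lee_fin.
- by move=> x _; rewrite lee_fin powR_ge0.
- by apply: measurable_funTS; exact: measurable_cauchy_stieltjes.
- exact: measurable_itv.
apply: eq_integral => x; rewrite inE/= in_itv/= andbT => x0.
have ax0 : 0 < 1 + a * x by rewrite ltr_pwDl// mulr_ge0// ltW.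
rewrite /= -!EFinM; congr EFin; rewrite -[LHS]mulrA -powRM ?(ltW ax0)//; last first.
  have : to_odds_fraction a x <= 1.
    by rewrite /to_odds_fraction ler_pdivrMr// mul1r lerDr.
  have : 0 <= to_odds_fraction a x by rewrite divr_ge0 ?mulr_ge0 ?(ltW ax0)// ltW.
  by move=> u0 u1; rewrite addr_ge0 ?subr_ge0// mulr_ge0// (le_trans ler01).
congr (_ * _ `^ _); rewrite /to_odds_fraction; field.
by rewrite gt_eqF.
Qed.

Lemma tilted_law_conull : q (~` `[0, 1]%classic) = 0%E.
Proof.
have mC : measurable (~` `[0, 1]%classic : set R).
  by apply: measurableC; exact: measurable_itv.
(* The mass is written as the integral of an indicator, which [integral_Q_law] pulls back to
   [x >= 0]; there [a x / (1 + a x)] lies in [[0, 1]]. *)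
rewrite -[LHS]mul1e -integral_cst// integral_mkcond integral_Q_law; last 2 first.
- by apply/(measurable_restrictT (cst 1%E)).
- by move=> u; apply: erestrict_ge0.
rewrite integral0_eq// => x; rewrite /= in_itv/= andbT => x0.
have ax0 : 0 < 1 + a * x by rewrite ltr_pwDl// mulr_ge0// ltW.
rewrite patchE memNset ?mule0// => h; apply: h; rewrite /= in_itv/=.
rewrite /to_odds_fraction ler_pdivrMr// mul1r lerDr ler01 andbT.
by rewrite divr_ge0 ?mulr_ge0 ?(ltW ax0)// ltW.
Qed.

Lemma tilted_law_is_M_law :
  is_M_law theta [the {measure set R -> \bar R} of thorin_image a nu] q.
Proof.
have [hnu _ _] := hmu.
split; first exact: thorin_thorin_image.
  apply/probability_conull => //.
  apply: (subset_measure0 _ _ _ tilted_law_conull).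
  - exact: measurableC.
  - by apply: measurableC; exact: measurable_itv.
  - by apply: subsetC => x; rewrite /= !in_itv/= andbT => /andP[].
move=> l l0; rewrite /thorin_exponent thorin_integral_thorin_image//=.
transitivity (\int[q]_u ((1 - u + u * (1 + l)) `^ (- theta))%:E)%E.
  by apply: eq_integral => u _; congr (_ `^ _)%:E; ring.
rewrite integral_tilted_law ?lerDl// kappaE cauchy_stieltjes_M_law; last first.
  by rewrite mulr_ge0 ?addr_ge0// ltW.
by rewrite -EFinM -expRD; congr (expR _)%:E; ring.
Qed.

End tilted_law.

(** * Lebesgue densities of [Q_tilde] and of the law of [xi] *)

Section tilted_density.
Context {R : realType}.
Variables (theta a : R) (a0 : 0 < a).
Variables (d : measure_display) (T : measurableType d) (P : probability T R).
Variables (M : {RV P >-> R}) (f : R -> R).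
Hypothesis M0 : distribution P M (~` `[0, +oo[%classic) = 0%E.
Hypothesis hf : has_density (fun B => P [set w | B (a * M w)]) f.

Let measurable_Q_tilde_density : measurable_fun setT (Q_tilde_density f).
Proof.
have [mf _ _] := hf.
apply: measurable_fun_ifT.
- by apply: measurable_and; exact: measurable_fun_ltr.
- apply: measurable_funM.
    apply: (measurableT_comp measurable_invr); apply: measurable_funX.
    exact: measurable_funB.
  apply: (measurableT_comp mf); apply: measurable_funM => //.
  by apply: (measurableT_comp measurable_invr); exact: measurable_funB.
- by [].
Qed.

Let Q_tilde_density_ge0 u : 0 <= Q_tilde_density f u.
Proof.
rewrite /Q_tilde_density; case: ifPn => // _.
by have [_ f0 _] := hf; rewrite mulr_ge0// invr_ge0 sqr_ge0.
Qed.

Lemma has_density_Q_tilde :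
  has_density (Q_tilde a (distribution P M)) (Q_tilde_density f).
Proof.
have [mf f0 fE] := hf; split => // B mB.
have mN : measurable (`]-oo, 0[%classic : set R) by exact: measurable_itv.
have maM : measurable_fun setT (fun w => a * M w) by exact: measurable_funM.
have maMV U : measurable U -> measurable [set w | U (a * M w)].
  by move=> mU; rewrite -[X in measurable X]setTI; exact: maM.
(* As [a M] is almost surely nonnegative and has a density, [f] has no mass on []-oo, 0]]. The
   integrals can then be confined to []0, +oo[], where the odds substitution applies. *)
have fN : (\int[lebesgue_measure]_(x in `]-oo, 0%R]) (f x)%:E = 0)%E.
  rewrite -integral_itv_bndo_bndc; last first.
    by apply/measurable_EFinP; exact: measurable_funTS.
  have PM0 : P (M @^-1` (~` `[0, +oo[)) = 0%E := M0.
  rewrite -fE//; apply: (subset_measure0 _ _ _ PM0).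
  - exact: (maMV _ mN).
  - by rewrite -[X in measurable X]setTI; apply: measurable_funP => //;
      apply: measurableC; exact: measurable_itv.
  - by move=> w /=; rewrite !in_itv/= andbT pmulr_rlt0// leNgt => ->.
(* [f] is the density of [a M] and not of [M]; since [to_odds_fraction a M] equals
   [to_odds_fraction 1 (a M)], [C] is the event expressed in terms of [a M]. *)
pose C : set R := to_odds_fraction 1 @^-1` B.
have mC : measurable C.
  by rewrite -[X in measurable X]setTI; exact: measurable_to_odds_fraction.
have m0y : measurable (`]0, +oo[%classic : set R) by exact: measurable_itv.
transitivity (\int[lebesgue_measure]_(x in C) (f x)%:E)%E.
  rewrite -fE//= /Q_tilde /distribution /pushforward; congr (P _).
  apply/seteqP; split => w /=; rewrite /C /to_odds_fraction /=;
    by rewrite !mul1r.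
transitivity (\int[lebesgue_measure]_(x in `]0%R, +oo[) ((\1_C x)%:E * (f x)%:E))%E.
  have CE : C = (C `&` `]0, +oo[) `|` (C `&` `]-oo, 0]).
    rewrite -setIUr (_ : _ `|` _ = setT) ?setIT//; apply/seteqP; split => // x _.
    by have [x0|x0] := leP x 0; [right|left]; rewrite /= in_itv/= ?x0.
  have mfE D : measurable_fun D (EFin \o f).
    by apply/measurable_EFinP; exact: measurable_funTS.
  have mCP : measurable (C `&` `]0, +oo[) by exact: measurableI.
  have mCN : measurable (C `&` `]-oo, 0]).
    by apply: measurableI => //; exact: measurable_itv.
  rewrite [in LHS]CE ge0_integral_setU; last 5 first.
  - exact: mCP.
  - exact: mCN.
  - exact: mfE.
  - by move=> x _; rewrite lee_fin.
  - rewrite disj_set2E; apply/eqP; rewrite -subset0 => x [[_ +] [_ +]].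
    by rewrite /= !in_itv/= andbT leNgt => ->.
  rewrite [X in (_ + X)%E](_ : _ = 0%E) ?adde0; last first.
    apply/eqP; rewrite eq_le; apply/andP; split; last first.
      by apply: integral_ge0 => x _; rewrite lee_fin.
    rewrite -fN; apply: ge0_subset_integral => //.
    - exact: mfE.
    - by move=> x _; rewrite lee_fin.
  rewrite integral_mkcond [RHS]integral_mkcond; apply: eq_integral => x _.
  rewrite !patchE in_setI indicE.
  by case: (x \in C); case: (x \in _); rewrite ?mul1e ?mul0e.
rewrite ge0_integral_odds; last 2 first.
- by apply: emeasurable_funM; apply/measurable_EFinP => //; exact: measurable_indic.
- by move=> x; rewrite mule_ge0 ?lee_fin.
rewrite integral_mkcond [RHS]integral_mkcond; apply: eq_integral => u _.
rewrite !patchE /Q_tilde_density mem_setE/= in_itv/=.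
case: ifPn => u01; last by case: ifP.
have /andP[u0 u1] := u01.
have uE : to_odds_fraction 1 (u / (1 - u)) = u.
  rewrite /to_odds_fraction; field.
  by apply/andP; split; apply/eqP; lra.
have uCB : (u / (1 - u) \in C) = (u \in B).
  by apply/idP/idP; rewrite !inE /C/= uE.
rewrite indicE uCB; case: (u \in B); rewrite ?mul1e ?mul0e ?mule0// EFinM.
Qed.

Lemma has_density_tilted (q : probability R R) :
    0 <= kappa theta a (distribution P M) ->
    (forall B, measurable B -> q B = Q_law theta a (distribution P M) B) ->
  has_density q (Q_density theta a (distribution P M) f).
Proof.
move=> kappa0 hq.
have mw : measurable_fun setT
    (fun u : R => kappa theta a (distribution P M) * (1 - u) `^ theta).
  apply: measurable_funM => //; apply: (measurableT_comp (measurable_powR _)).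
  exact: measurable_funB.
split.
- exact: measurable_funM.
- by move=> u; rewrite mulr_ge0// mulr_ge0// powR_ge0.
- move=> B mB; rewrite hq// /Q_law integral_mkcond.
  rewrite (integral_has_density has_density_Q_tilde); last 2 first.
  + apply: (measurable_restrictT _ mB).1; apply/measurable_EFinP.
    exact: measurable_funTS.
  + by move=> u; apply: erestrict_ge0 => x _; rewrite lee_fin mulr_ge0// powR_ge0.
  rewrite [RHS]integral_mkcond; apply: eq_integral => u _; rewrite !patchE.
  by case: ifP; rewrite ?mule0// -EFinM mulrC.
Qed.

End tilted_density.

(** * The law of [A], and the proposition *)

Lemma mixture_is_M_law (R : realType) (alpha theta c : R)
    (nu : {measure set R -> \bar R}) (chi mu : probability R R)
    (d : measure_display) (T : measurableType d) (P : probability T R)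
    (xi A : {RV P >-> R}) (K : R.-pker R ~> R) :
    0 < alpha < 1 -> 0 < c -> is_M_law theta nu mu ->
    (forall B, measurable B ->
      distribution P xi B = Q_law theta (c `^ alpha) mu B) ->
    (forall p : R, 0 <= p <= 1 -> is_occupation_law alpha theta p (K p)) ->
    conditional_law xi A K ->
    chi `]-oo, 0]%classic = 0%E ->
    (forall y l : R, 0 < y -> 0 <= l ->
      (\int[chi]_(x in `]0%R, +oo[) (ln (1 + l * to_odds_fraction y x))%:E =
       (alpha^-1 * (ln (1 + ((1 + l) * y) `^ alpha) - ln (1 + y `^ alpha)))%:E)%E) ->
  (forall l : R, 0 <= l ->
    [/\ cauchy_stieltjes (alpha * theta) (distribution P A) l =
          (\int[distribution P xi]_(p in `[0%R, 1%R])
             cauchy_stieltjes (alpha * theta) (K p) l)%E,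
        (\int[distribution P xi]_(p in `[0%R, 1%R])
           cauchy_stieltjes (alpha * theta) (K p) l)%E =
          (\int[distribution P xi]_(p in `[0%R, 1%R])
             ((1 - p + p * (1 + l) `^ alpha) `^ (- theta))%:E)%E &
        cauchy_stieltjes (alpha * theta) (distribution P A) l =
          (cauchy_stieltjes theta mu ((1 + l) `^ alpha * c `^ alpha) /
           cauchy_stieltjes theta mu (c `^ alpha))%E]) /\
  is_M_law (alpha * theta) [the {measure set R -> \bar R} of Lambda_mix alpha c chi nu]
    (distribution P A).
Proof.
move=> alpha01 c0 hmu hxi hK hA chi0 chi_ln.
have /andP[alpha0 _] := alpha01; have [hnu _ _] := hmu.
have a0 : 0 < c `^ alpha by exact: powR_gt0.
have m01 : measurable (`[0, 1]%classic : set R) by exact: measurable_itv.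
have xi01 := tilted_law_conull a0 hmu hxi.
(* The mixture is restricted to [[0, 1]], which carries the law of [xi], because [K p] is an
   occupation law only for such [p]. *)
have AE U : measurable U ->
    (distribution P A U = \int[distribution P xi]_(p in `[0%R, 1%R]) K p U)%E.
  move=> mU; rewrite (ge0_integral_conull m01 xi01)//; last exact: measurable_kernel.
  by rewrite -hA//= setTI.
have E1 l : cauchy_stieltjes (alpha * theta) (distribution P A) l =
    (\int[distribution P xi]_(p in `[0%R, 1%R])
       cauchy_stieltjes (alpha * theta) (K p) l)%E.
  rewrite [LHS](ge0_integral_mixture (nu := distribution P xi) m01 (k := K))//.
  - by move=> U mU; exact: measurable_kernel.
  - by move=> y; rewrite lee_fin powR_ge0.
  - exact: measurable_cauchy_stieltjes.
have E2 l : 0 <= l -> (\int[distribution P xi]_(p in `[0%R, 1%R])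
      cauchy_stieltjes (alpha * theta) (K p) l)%E =
    (\int[distribution P xi]_(p in `[0%R, 1%R])
      ((1 - p + p * (1 + l) `^ alpha) `^ (- theta))%:E)%E.
  move=> l0; apply: eq_integral => p; rewrite inE/= in_itv/= => p01.
  by have [_ _] := hK _ p01; apply.
have K1 l : 0 <= l -> 1 <= (1 + l) `^ alpha.
  by move=> l0; rewrite -[leLHS](powRr0 (1 + l)) ler_powR ?lerDl// ltW.
have E3 l : 0 <= l -> cauchy_stieltjes (alpha * theta) (distribution P A) l =
    ((kappa theta (c `^ alpha) mu)%:E *
     cauchy_stieltjes theta mu ((1 + l) `^ alpha * c `^ alpha))%E.
  move=> l0; rewrite E1 E2// (ge0_integral_conull m01 xi01).
  - by rewrite (integral_tilted_law a0 hmu hxi)// K1.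
  - apply/measurable_EFinP; apply: (measurableT_comp (measurable_powR _)).
    by apply: measurable_funD; [exact: measurable_funB|exact: measurable_funM].
  - by move=> p; rewrite lee_fin powR_ge0.
split; first move=> l l0; first split => //; first exact: E2.
  rewrite E3// (kappaE a0 hmu) [X in (_ / X)%E](cauchy_stieltjes_M_law hmu) ?(ltW a0)//.
  by rewrite muleC inver gt_eqF ?expR_gt0// expRN invrK.
split; first exact: thorin_Lambda_mix.
  apply/probability_conull; first exact: measurable_itv.
  have mC0y : measurable (~` `[0, +oo[%classic : set R).
    by apply: measurableC; exact: measurable_itv.
  apply: etrans (AE _ mC0y) _.
  rewrite integral0_eq// => p; rewrite /= in_itv/= => p01.
  have [KT K01 _] := hK _ p01.
  have mC01 : measurable (~` `[0, 1]%classic : set R) by exact: measurableC.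
  have KC01 : K p (~` `[0, 1]) = 0%E.
    move: KT; rewrite -(setUv `[0%R, 1%R]%classic) measureU// ?setICr//.
    rewrite [X in (X + _)%E]K01 => /(congr1 (fun z => z - 1)%E).
    by rewrite addeAC subee// add0e.
  apply: (subset_measure0 _ _ _ KC01) => //.
  by apply: subsetC => x; rewrite /= !in_itv/= andbT => /andP[].
move=> l l0; rewrite E3// (kappaE a0 hmu) (cauchy_stieltjes_M_law hmu); last first.
  by rewrite mulr_ge0 ?powR_ge0.
rewrite [thorin_exponent (Lambda_mix _ _ _ _) l]/thorin_exponent.
rewrite (thorin_integral_Lambda_mix alpha01 c0 hnu chi0 chi_ln l0)/= -EFinM -expRD.
(* The order [alpha * theta] cancels the factor [alpha^-1] in the Thorin exponent of
   [Lambda_mix]. *)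
by congr (expR _)%:E; field; rewrite gt_eqF.
Qed.

Theorem proposition5p2 (R : realType) (alpha theta c : R)
    (halpha : 0 < alpha < 1) (htheta : 0 < theta) (hc : 0 < c)
    (nu : {measure set R -> \bar R}) (hnu : thorin nu)
    (d : measure_display) (T : measurableType d) (P : probability T R)
    (* X_alpha is distributed as S / S', a ratio of independent stable
       variables *)
    (S S' X : {RV P >-> R})
    (hS : is_stable_law alpha (distribution P S))
    (hS' : is_stable_law alpha (distribution P S'))
    (hSS' : independent_RVs S S')
    (hX : forall B, measurable B ->
      distribution P X B = P [set w | B (S w / S' w)])
    (* M is M_theta(nu) *)
    (M : {RV P >-> R})
    (hM : is_M_law theta nu (distribution P M))
    (* xi is xi_theta, of law Q_theta( . |nu) *)
    (xi : {RV P >-> R})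
    (hxi : forall B, measurable B ->
      distribution P xi B = Q_law theta (c `^ alpha) (distribution P M) B)
    (* K p is the law of A_(alpha,p) and A is A_(alpha,xi) *)
    (K : R.-pker R ~> R)
    (hK : forall p : R, 0 <= p <= 1 -> is_occupation_law alpha theta p (K p))
    (A : {RV P >-> R}) (hA : conditional_law xi A K)
    (* G is G_(alpha theta), independent of A *)
    (G : {RV P >-> R})
    (hG : has_density (distribution P G) (gamma_pdf (alpha * theta)))
    (hGA : independent_RVs G A)
    (L : {RV P >-> R})
    (hL : forall B, measurable B ->
      distribution P L B = P [set w | B (G w * A w)]) :
  (* the form of the densities of Q_tilde and Q, and of kappa *)
  (forall f : R -> R,
     has_density (fun B => P [set w | B (c `^ alpha * M w)]) f ->
     has_density (Q_tilde (c `^ alpha) (distribution P M)) (Q_tilde_density f)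
     /\ has_density (distribution P xi)
          (Q_density theta (c `^ alpha) (distribution P M) f)) /\
  kappa theta (c `^ alpha) (distribution P M) =
    expR (theta * thorin_exponent nu (c `^ alpha)) /\
  is_M_law theta (thorin_image (c `^ alpha) nu) (distribution P xi) /\
  (* (i) *)
  (forall l : R, 0 <= l ->
    [/\ cauchy_stieltjes (alpha * theta) (distribution P A) l =
          (\int[distribution P xi]_(p in `[0%R, 1%R])
             cauchy_stieltjes (alpha * theta) (K p) l)%E,
        (\int[distribution P xi]_(p in `[0%R, 1%R])
           cauchy_stieltjes (alpha * theta) (K p) l)%E =
          (\int[distribution P xi]_(p in `[0%R, 1%R])
             ((1 - p + p * (1 + l) `^ alpha) `^ (- theta))%:E)%E &
        cauchy_stieltjes (alpha * theta) (distribution P A) l =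
          (cauchy_stieltjes theta (distribution P M)
             ((1 + l) `^ alpha * c `^ alpha) /
           cauchy_stieltjes theta (distribution P M) (c `^ alpha))%E]) /\
  (* (ii) *)
  is_M_law (alpha * theta) (Lambda_mix alpha c (distribution P X) nu)
    (distribution P A) /\
  is_GGC (alpha * theta) (Lambda_mix alpha c (distribution P X) nu)
    (distribution P L).
Proof.
have a0 : 0 < c `^ alpha by exact: powR_gt0.
have chi0 := stable_ratio_le0 halpha hS hS' hX.
have chi_ln := integral_log_stable_ratio halpha hS hS' hSS' hX.
have [hcs hML] := mixture_is_M_law halpha hc hM hxi hK hA chi0 chi_ln.
split; [|split; [|split; [|split; [|split]]]].
- move=> f hf; have M0 := M_law_lt0 hM.
  split; first exact: has_density_Q_tilde.
  by apply: has_density_tilted => //; rewrite (kappaE a0 hM) expR_ge0.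
- by rewrite (kappaE a0 hM).
- exact (tilted_law_is_M_law a0 hM hxi).
- exact: hcs.
- exact: hML.
- exact: GGC_gamma_M_law hML hG hGA hL.
Qed.
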